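(* Let $A$ be an artin algebra, let $S$ be a localizable simple $A$-module, and let $\eta_A\colon A\to L(A)$ be the left retraction associated to $S$. Identify $S^\perp$ with $L(A)\text{-mod}$, so that $i_\lambda$ is regarded as a functor $A\text{-mod}\to L(A)\text{-mod}$. Let $I(S)$ be the injective envelope of $S$ in $A\text{-mod}$. Then $A$ is Gorenstein if and only if $L(A)$ is Gorenstein and $\mathrm{proj.dim}_{L(A)}\, i_\lambda(I(S))<\infty$.
   Context: All algebras are artin algebras over a commutative artinian ring; modules are finitely generated left modules and $A\text{-mod}$ is their category. Left retractions. A simple $A$-module $S$ is localizable if $\mathrm{proj.dim}_A S\le 1$ and $\mathrm{Ext}^1_A(S,S)=0$. Put $S^\perp=\{X\in A\text{-mod}\mid \mathrm{Hom}_A(S,X)=0=\mathrm{Ext}^1_A(S,X)\}$. This is an exact abelian subcategory of $A\text{-mod}$ and the inclusion $i\colon S^\perp\to A\text{-mod}$ has an exact left adjoint $i_\lambda$. Let $L=i\,i_\lambda$ and let $\eta\colon \mathrm{Id}\to L$ be the unit of the adjunction $(i_\lambda,i)$. For $x\in L(A)$ let $r_x\colon A\to L(A)$, $r_x(a)=a.x$; the product $x\star y=L(\eta_A)^{-1}(L(r_y)(x))$ makes $L(A)$ an algebra and $\eta_A\colon A\to L(A)$ an algebra homomorphism, called the left retraction associated to $S$. There is an equivalence $S^\perp\simeq L(A)\text{-mod}$ under which $i$ becomes restriction of scalars along $\eta_A$ and $i_\lambda$ becomes $L(A)\otimes_A-$. An artin algebra $A$ is Gorenstein if the regular module $A$ has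 finite injective dimension both as a left and as a right module. *)

(* Defs.v *)
From HB Require Import structures.
From mathcomp Require Import all_boot all_order all_algebra.

Set Implicit Arguments.
Unset Strict Implicit.
Unset Printing Implicit Defensive.

Import GRing.Theory.
Local Open Scope ring_scope.

(* Submodules and ideals are Prop-valued predicates, so that no decidability
   of membership is imposed. *)
Definition is_submodule (A : pzRingType) (M : lmodType A) (N : M -> Prop) :=
  N 0 /\ forall (a : A) (x y : M), N x -> N y -> N (a *: x + y).

Definition finitely_generated (A : pzRingType) (M : lmodType A) :=
  exists (n : nat) (e : 'I_n -> M),
    forall x : M, exists c : 'I_n -> A, x = \sum_(i < n) c i *: e i.

Definition artinian (R : comPzRingType) :=
  forall J : nat -> R^o -> Prop,
    (forall n, is_submodule (J n)) ->
    (forall n x, J n.+1 x -> J n x) ->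
    exists N, forall n, (N <= n)%N -> forall x, J N x -> J n x.

Definition artin_algebra (R : comNzRingType) (A : algType R) :=
  artinian R /\ finitely_generated (A : lmodType R).

(* Objects of A-mod.  A right A-module is a left module over the converse
   ring A^c.  All rings are possibly zero (pzRingType), because L(A) = 0 may
   occur, e.g. when A is a field. *)
Record fgModType (A : pzRingType) := FgMod {
  fgmod_sort :> lmodType A;
  fgmodP : finitely_generated fgmod_sort }.

Section ModuleCategory.
Variable A : pzRingType.
Implicit Types M N X Y Z S : fgModType A.

Definition surj (T U : Type) (f : T -> U) := forall y, exists x, f x = y.

Definition exact_at (T : Type) (U V : zmodType) (f : T -> U) (g : U -> V) :=
  forall y, g y = 0 <-> exists x, f x = y.

Definition is_zero M := forall x : M, x = 0.

Definition simple M :=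
  (exists x : M, x <> 0) /\
  forall N : M -> Prop, is_submodule N ->
    (forall x, N x -> x = 0) \/ (forall x, N x).

Definition projective (P : fgModType A) :=
  forall X Y (f : {linear X -> Y}) (g : {linear P -> Y}),
    surj f -> exists h : {linear P -> X}, forall x, f (h x) = g x.

Definition injective_module (I : fgModType A) :=
  forall X Y (f : {linear X -> Y}) (g : {linear X -> I}),
    injective f -> exists h : {linear Y -> I}, forall x, h (f x) = g x.

(* ... -> P_1 -> P_0 -> M -> 0 *)
Record proj_resolution M := ProjResolution {
  pres_obj : nat -> fgModType A;
  pres_d : forall i, {linear pres_obj i.+1 -> pres_obj i};
  pres_aug : {linear pres_obj 0%N -> M};
  pres_proj : forall i, projective (pres_obj i);
  pres_surj : surj pres_aug;
  pres_exact0 : exact_at (pres_d 0%N) pres_aug;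
  pres_exact : forall i, exact_at (pres_d i.+1) (pres_d i) }.

(* 0 -> M -> I^0 -> I^1 -> ... *)
Record inj_resolution M := InjResolution {
  ires_obj : nat -> fgModType A;
  ires_d : forall i, {linear ires_obj i -> ires_obj i.+1};
  ires_aug : {linear M -> ires_obj 0%N};
  ires_inj : forall i, injective_module (ires_obj i);
  ires_mono : injective ires_aug;
  ires_exact0 : exact_at ires_aug (ires_d 0%N);
  ires_exact : forall i, exact_at (ires_d i) (ires_d i.+1) }.

Definition proj_dim_le M (n : nat) :=
  exists P : proj_resolution M, forall i, (n < i)%N -> is_zero (pres_obj P i).

Definition inj_dim_le M (n : nat) :=
  exists I : inj_resolution M, forall i, (n < i)%N -> is_zero (ires_obj I i).

Definition proj_dim_finite M := exists n, proj_dim_le M n.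
Definition inj_dim_finite M := exists n, inj_dim_le M n.

(* Ext^1 is Yoneda's: classes of short exact sequences 0 -> X -> E -> S -> 0,
   the zero element being the class of the split sequence. *)
Record extension S X := Extension {
  ext_obj : fgModType A;
  ext_in : {linear X -> ext_obj};
  ext_out : {linear ext_obj -> S};
  ext_mono : injective ext_in;
  ext_epi : surj ext_out;
  ext_exact : exact_at ext_in ext_out }.

(* By the five lemma such an h is an isomorphism. *)
Definition ext_equiv S X (E E' : extension S X) :=
  exists h : {linear ext_obj E -> ext_obj E'},
    (forall x, h (ext_in E x) = ext_in E' x) /\
    (forall e, ext_out E' (h e) = ext_out E e).

Section Split.
Variables S X : fgModType A.

Definition dsum : lmodType A := (X * S)%type.

Lemma dsum_fg : finitely_generated dsum.
Proof.
case: (fgmodP X) => m [e He]; case: (fgmodP S) => n [f Hf].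
exists (m + n)%N, (fun i => match split i with
  | inl k => (e k, 0) | inr k => (0, f k) end) => -[x s].
have [c ->] := He x; have [d ->] := Hf s.
exists (fun i => match split i with inl k => c k | inr k => d k end).
transitivity (\sum_(i < m) c i *: ((e i, 0) : dsum) +
              \sum_(i < n) d i *: ((0, f i) : dsum)); last first.
  have spl (i : 'I_m) : split (lshift n i) = inl i := unsplitK (inl i).
  have spr (i : 'I_n) : split (rshift m i) = inr i := unsplitK (inr i).
  by rewrite big_split_ord; congr (_ + _); apply: eq_bigr => i _;
     rewrite ?spl ?spr.
apply/eqP; rewrite xpair_eqE /= !raddf_sum /=; apply/andP; split; apply/eqP.
  by rewrite -[LHS]addr0; congr (_ + _); rewrite big1 // => i _;
     rewrite scaler0.
by rewrite -[LHS]add0r; congr (_ + _); rewrite big1 // => i _;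
   rewrite scaler0.
Qed.

Definition dsum_fgmod := FgMod dsum_fg.

Definition dsum_in (x : X) : dsum_fgmod := (x, 0).
Definition dsum_out (z : dsum_fgmod) : S := z.2.

Fact dsum_in_linear : linear dsum_in.
Proof. by move=> a x y; congr pair; rewrite /= scaler0 addr0. Qed.
HB.instance Definition _ :=
  GRing.isLinear.Build A X dsum_fgmod _ dsum_in dsum_in_linear.

Fact dsum_out_linear : linear dsum_out.
Proof. by []. Qed.
HB.instance Definition _ :=
  GRing.isLinear.Build A dsum_fgmod S _ dsum_out dsum_out_linear.

Fact dsum_in_inj : injective dsum_in.
Proof. by move=> x y []. Qed.

Fact dsum_out_surj : surj dsum_out.
Proof. by move=> s; exists (0, s). Qed.

Fact dsum_exact : exact_at dsum_in dsum_out.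
Proof.
move=> [x s]; split=> [/= ->|[y [_ <-]] //].
by exists x.
Qed.

Definition split_extension : extension S X :=
  @Extension S X dsum_fgmod dsum_in dsum_out
    dsum_in_inj dsum_out_surj dsum_exact.

End Split.

Definition Ext1_zero S X :=
  forall E : extension S X, ext_equiv E (split_extension S X).

Definition Hom_zero S X := forall (f : {linear S -> X}) (s : S), f s = 0.

Definition localizable S := [/\ simple S, proj_dim_le S 1 & Ext1_zero S S].

Record perpType S := Perp {
  perp_obj :> fgModType A;
  perpP : Hom_zero S perp_obj /\ Ext1_zero S perp_obj }.

(* j : S -> I is an injective envelope: an essential monomorphism of A-mod
   into an injective object. *)
Definition injective_envelope S (I : fgModType A) (j : {linear S -> I}) :=
  [/\ injective_module I, injective j &
      forall Y (g : {linear I -> Y}),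
        injective (fun s => g (j s)) -> injective g].

Fact regular_is_fg : finitely_generated (A^o : lmodType A).
Proof.
exists 1%N, (fun=> 1) => x; exists (fun=> x).
by rewrite big_ord1; exact/esym/mulr1.
Qed.

Definition regular_mod : fgModType A := FgMod regular_is_fg.

(* A left adjoint of the inclusion of S^perp, presented by its unit: eta is
   natural and each component is a universal arrow to S^perp. *)
Record left_adjoint S := LeftAdjoint {
  ilam : fgModType A -> perpType S;
  ilam_map : forall X Y, {linear X -> Y} -> {linear ilam X -> ilam Y};
  ilam_id : forall X, ilam_map (idfun : {linear X -> X}) =1 idfun;
  ilam_comp : forall X Y Z (f : {linear X -> Y}) (g : {linear Y -> Z}),
    ilam_map (g \o f : {linear X -> Z}) =1 ilam_map g \o ilam_map f;
  eta : forall X, {linear X -> ilam X};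
  eta_natural : forall X Y (f : {linear X -> Y}) (x : X),
    ilam_map f (eta X x) = eta Y (f x);
  eta_universal : forall X (Y : perpType S) (f : {linear X -> Y}),
    exists2 g : {linear ilam X -> Y}, (forall x, g (eta X x) = f x) &
      forall g' : {linear ilam X -> Y},
        (forall x, g' (eta X x) = f x) -> g' =1 g }.

End ModuleCategory.

Definition gorenstein (A : pzRingType) :=
  inj_dim_finite (regular_mod A) /\ inj_dim_finite (regular_mod A^c).

Section Retraction.
Variables (A : pzRingType) (S : fgModType A) (F : left_adjoint S).

(* r_x : A -> M, a |-> a.x *)
Definition orbit_map (M : lmodType A) (x : M) (a : A^o) : M := (a : A) *: x.

Fact orbit_map_linear (M : lmodType A) (x : M) : linear (orbit_map x).
Proof. by move=> a b c; rewrite /orbit_map scalerDl scalerA. Qed.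
HB.instance Definition _ (M : lmodType A) (x : M) :=
  GRing.isLinear.Build A A^o M _ (orbit_map x) (orbit_map_linear x).

Definition rmap (M : fgModType A) (x : M) : {linear regular_mod A -> M} :=
  orbit_map x.

Definition surj_inv (X : choiceType) (Y : eqType) (f : X -> Y)
    (f_surj : forall y, exists x, f x == y) (y : Y) : X := xchoose (f_surj y).

Lemma surj_invK (X : choiceType) (Y : eqType) (f : X -> Y) f_surj :
  cancel (@surj_inv X Y f f_surj) f.
Proof. by move=> y; apply/eqP/(xchooseP (f_surj y)). Qed.

Lemma eta_ext (X : fgModType A) (Y : perpType S)
    (g h : {linear ilam F X -> Y}) :
  (forall x, g (eta F X x) = h (eta F X x)) -> g =1 h.
Proof.
move=> gh; have [k _ Uk] := eta_universal F (h \o eta F X : {linear X -> Y}).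
by move=> x; rewrite (Uk g gh) (Uk h).
Qed.

Lemma eta_perp_bij (X : perpType S) : bijective (eta F X).
Proof.
have [g gK _] := eta_universal F (idfun : {linear X -> X}).
exists g => // y.
exact: (@eta_ext X (ilam F X) (eta F X \o g) idfun
          (fun x => congr1 (eta F X) (gK x)) y).
Qed.

Lemma ilam_eta (X : fgModType A) :
  ilam_map F (eta F X) =1 eta F (ilam F X).
Proof. by apply: eta_ext => x; rewrite eta_natural. Qed.

Fact eta_perp_surj (X : perpType S) y : exists x, eta F X x == y.
Proof. by have [g _ gK] := eta_perp_bij X; exists (g y); rewrite gK. Qed.

Fact ilam_eta_surj (X : fgModType A) y : exists x, ilam_map F (eta F X) x == y.
Proof. by have [x] := eta_perp_surj y; exists x; rewrite ilam_eta. Qed.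

Definition retraction : Type := ilam F (regular_mod A).
HB.instance Definition _ :=
  GRing.Zmodule.copy retraction (ilam F (regular_mod A)).

Definition retraction_map (a : A) : retraction := eta F (regular_mod A) a.

(* x * y = L(eta_A)^-1 (L(r_y) x) *)
Definition star (x y : retraction) : retraction :=
  surj_inv (@ilam_eta_surj (regular_mod A)) (ilam_map F (rmap y) x).

(* The L(A)-action on X in S^perp whose restriction along eta_A is the given
   A-action; it is determined by universality of eta_A, and for X = L(A) it
   is the product star. *)
Definition perp_act (X : perpType S) (l : retraction) (x : X) : X :=
  surj_inv (@eta_perp_surj X) (ilam_map F (rmap x) l).

Section Action.
Variable X : perpType S.

Lemma perp_actK (l : retraction) (x : X) :
  eta F X (perp_act l x) = ilam_map F (rmap x) l.
Proof. exact: (surj_invK (@eta_perp_surj X)). Qed.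

Lemma perp_act_eta (a : A) (x : X) : perp_act (retraction_map a) x = a *: x.
Proof.
by apply: (bij_inj (eta_perp_bij X)); rewrite perp_actK eta_natural.
Qed.

Lemma perp_act_linear (x : X) :
  linear ((fun l => perp_act l x) : ilam F (regular_mod A) -> X).
Proof.
move=> a l m; apply: (bij_inj (eta_perp_bij X)).
by rewrite linearP !perp_actK linearP.
Qed.

Lemma perp_act_unique (x : X) (g : ilam F (regular_mod A) -> X) :
  linear g -> (forall a, g (retraction_map a) = a *: x) ->
  forall l, g l = perp_act l x.
Proof.
move=> lg gE l.
pose G : {linear ilam F (regular_mod A) -> X} :=
  HB.pack g (GRing.isLinear.Build A _ _ _ g lg).
pose h := fun l => perp_act l x.
pose H : {linear ilam F (regular_mod A) -> X} :=
  HB.pack h (GRing.isLinear.Build A _ _ _ h (perp_act_linear x)).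
by apply: (eta_ext (g := G) (h := H)) => a; rewrite /= gE /h perp_act_eta.
Qed.

Lemma perp_actDr (l : retraction) : {morph @perp_act X l : x y / x + y}.
Proof.
move=> x y; symmetry.
apply: (perp_act_unique (g := fun l => perp_act l x + perp_act l y)).
  by move=> a m n; rewrite !perp_act_linear scalerDr addrACA.
by move=> a; rewrite !perp_act_eta scalerDr.
Qed.

Lemma perp_actDl (x : X) :
  {morph (fun l => perp_act l x) : l m / l + m}.
Proof.
by move=> l m; have := perp_act_linear x 1 l m; rewrite !scale1r.
Qed.

Lemma perp_actZ (x : X) (a : A) (l : ilam F (regular_mod A)) :
  perp_act (a *: l : ilam F (regular_mod A)) x = a *: perp_act l x.
Proof.
have act0 : perp_act 0 x = 0.
  by apply: (addrI (perp_act 0 x)); rewrite -perp_actDl !addr0.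
by have := perp_act_linear x a l 0; rewrite /= addr0 act0 addr0.
Qed.

Lemma perp_act1 (x : X) : perp_act (retraction_map 1) x = x.
Proof. by rewrite perp_act_eta scale1r. Qed.

End Action.

Lemma starE (x y : retraction) :
  star x y = perp_act (X := ilam F (regular_mod A)) x y.
Proof.
apply: (bij_inj (eta_perp_bij (ilam F (regular_mod A)))).
by rewrite perp_actK -ilam_eta; exact: surj_invK.
Qed.

Lemma perp_actA (X : perpType S) (l m : retraction) (x : X) :
  perp_act l (perp_act m x) = perp_act (star l m) x.
Proof.
symmetry; apply: (perp_act_unique (g := fun l => perp_act (star l m) x)).
  by move=> a p q; rewrite !starE perp_act_linear perp_act_linear.
by move=> a; rewrite starE perp_act_eta perp_actZ.
Qed.

Fact star1r : left_id (retraction_map 1) star.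
Proof. by move=> x; rewrite starE perp_act1. Qed.

Fact starr1 : right_id (retraction_map 1) star.
Proof.
move=> l; rewrite starE; symmetry.
by apply: (@perp_act_unique (ilam F (regular_mod A)) _ id) => // a;
   rewrite /retraction_map -linearZ; congr (eta F _ _); exact/esym/mulr1.
Qed.

Fact starA : associative star.
Proof.
move=> x y z; rewrite [LHS]starE [RHS]starE starE.
exact: (@perp_actA (ilam F (regular_mod A))).
Qed.

Fact starDl : left_distributive star +%R.
Proof. by move=> x y z; rewrite !starE perp_actDl. Qed.

Fact starDr : right_distributive star +%R.
Proof. by move=> x y z; rewrite !starE perp_actDr. Qed.

HB.instance Definition _ := GRing.Zmodule_isPzRing.Build retraction
  starA star1r starr1 starDl starDr.

Fact retraction_map_zmod : zmod_morphism retraction_map.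
Proof. by move=> a b; exact: (raddfB (eta F (regular_mod A))). Qed.

Fact retraction_map_monoid : monoid_morphism retraction_map.
Proof.
split=> // a b; rewrite [RHS]starE perp_act_eta.
by rewrite /retraction_map -linearZ.
Qed.

HB.instance Definition _ :=
  GRing.isZmodMorphism.Build A retraction retraction_map retraction_map_zmod.
HB.instance Definition _ :=
  GRing.isMonoidMorphism.Build A retraction retraction_map
    retraction_map_monoid.

(* The object of L(A)-mod corresponding to X under S^perp ~ L(A)-mod. *)
Definition perp_carrier (X : perpType S) : Type := X.
HB.instance Definition _ (X : perpType S) :=
  GRing.Zmodule.copy (perp_carrier X) X.

Section PerpModule.
Variable X : perpType S.

Definition perp_scale (l : retraction) (x : perp_carrier X) : perp_carrier X :=
  @perp_act X l x.

Fact perp_scaleA l m x :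
  perp_scale l (perp_scale m x) = perp_scale (l * m) x.
Proof. exact: (@perp_actA X). Qed.

Fact perp_scale1 : left_id 1 perp_scale.
Proof. exact: (@perp_act1 X). Qed.

Fact perp_scaleDr : right_distributive perp_scale +%R.
Proof. exact: (@perp_actDr X). Qed.

Fact perp_scaleDl x : {morph perp_scale^~ x : l m / l + m}.
Proof. exact: (@perp_actDl X). Qed.

HB.instance Definition _ := GRing.Zmodule_isLmodule.Build retraction
  (perp_carrier X) perp_scaleA perp_scale1 perp_scaleDr perp_scaleDl.

Lemma perp_scale_eta (a : A) (x : X) :
  retraction_map a *: (x : perp_carrier X) = (a *: x : X).
Proof. exact: perp_act_eta. Qed.

Fact perp_carrier_fg : finitely_generated (perp_carrier X).
Proof.
have [n [e He]] := fgmodP X; exists n, e => x.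
have [c ->] := He x; exists (fun i => retraction_map (c i)).
by apply: eq_bigr => i _; rewrite perp_scale_eta.
Qed.

Definition perp_mod : fgModType retraction := FgMod perp_carrier_fg.

End PerpModule.

End Retraction.

(* Main.v *)
Require Import Defs.
From HB Require Import structures.
From mathcomp Require Import all_boot all_order all_algebra.
From mathcomp Require Import boolp classical_sets.

Set Implicit Arguments.
Unset Strict Implicit.
Unset Printing Implicit Defensive.

Import GRing.Theory.
Local Open Scope ring_scope.

(** The proof compares [A] with [L(A)] by the adjoint pair of the localization
    functor, which is exact, and restriction of scalars, also exact. The unit
    [X -> L X] has kernel and cokernel filtered by copies of [S]: for the kernel
    because [X] modulo its largest such submodule embeds into an object of
    [S^perp] ([eta_ker]), for the cokernel by universality alone ([eta_coker]).
    As [S] has projective dimension at most one, [X] and [L X] always have finite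
    projective dimension together ([fpd_L_iff]); if [S] has finite injective
    dimension they also have finite injective dimension together ([fid_L_iff]).
    Localization preserves projectives and restriction preserves injectives, so
    that finite projective and injective dimension can be moved between [A] and
    [L(A)] ([fpd_L], [fpd_res], [fid_res], [res_fid]).

    Only left modules can be localized in this way, so the condition on the
    injective dimension of the right module [A] is first rewritten: it says that
    all injective left modules have finite projective dimension ([gorensteinP]).
    This rests on the duality of an artin algebra over [R], which is constructed
    here from a finitely generated injective [R]-module that contains every simple
    module exactly once ([dualizing_exists]), and on the fact that a commutative
    artinian ring has finite length ([artinian_length]). The duality also provides
    finitely generated injective modules in sufficient number and reduces the
    properties of injective dimension to those of projective dimension.

    If [A] is Gorenstein, then [S] has finite injective dimension, and the
    conditions on [L(A)] follow by localization: an injective [L(A)]-module is the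
    localization of an injective [A]-module, namely its restriction. Conversely,
    [L(I(S)) = I(S) / S] ([envelope_ses]), because [Ext^1(S, S) = 0] forces the
    quotient into [S^perp]. If this module has finite projective dimension over the
    Gorenstein algebra [L(A)], then its injective dimension is finite as well, and
    so [S] has finite injective dimension over [A] and [I(S)] finite projective
    dimension. The former gives the injective dimension of [A] from that of [L(A)],
    the latter the projective dimension of every injective [A]-module, which is a
    retract of copies of [I(S)] and of a restricted injective [L(A)]-module
    ([injective_fpd]). *)

(** * Linear maps, submodules and quotients *)

Definition mklin (A : pzRingType) (X Y : lmodType A) (f : X -> Y)
    (lf : linear f) : {linear X -> Y} :=
  HB.pack f (GRing.isLinear.Build A X Y *:%R f lf).

Section LinearGraphs.
Variable A : pzRingType.
Implicit Types K M Q X Y Z : lmodType A.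

(** Linear maps obtained by diagram chases come from this lemma: choices of
    preimages need not be linear, only the relation they are taken from. *)
Lemma linear_graph X Y (G : X -> Y -> Prop) :
  (forall x, exists y, G x y) -> (forall y, G 0 y -> y = 0) ->
  (forall a x x' y y', G x y -> G x' y' -> G (a *: x + x') (a *: y + y')) ->
  exists f : {linear X -> Y}, forall x, G x (f x).
Proof.
move=> tot G0 Glin.
have uniqG x y y' : G x y -> G x y' -> y = y'.
  move=> Gy Gy'; apply/eqP; rewrite -subr_eq0; apply/eqP/G0.
  have := Glin (-1) _ _ _ _ Gy' Gy.
  by rewrite !scaleN1r addNr [_ + y]addrC.
have [f fP] := choice tot.
have lf : linear f.
  by move=> a x y; apply: (uniqG (a *: x + y)); [exact: fP | exact: Glin].
by exists (mklin lf).
Qed.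

Lemma linear_lift X K M (i : {linear K -> M}) (f : {linear X -> M}) :
  injective i -> (forall x, exists k, i k = f x) ->
  exists g : {linear X -> K}, forall x, i (g x) = f x.
Proof.
move=> injf fK.
have [||g gP] := linear_graph (G := fun x k => i k = f x) fK.
- by move=> k; rewrite linear0 => i0; apply: injf; rewrite i0 linear0.
- by move=> a x x' y y' e e'; rewrite !linearP e e'.
by exists g.
Qed.

Lemma linear_factor M Q Z (p : {linear M -> Q}) (f : {linear M -> Z}) :
  surj p -> (forall x, p x = 0 -> f x = 0) ->
  exists g : {linear Q -> Z}, forall x, g (p x) = f x.
Proof.
move=> sp ker.
have [|||g gP] := @linear_graph Q Z (fun q z => exists2 x, p x = q & f x = z).
- by move=> q; have [x <-] := sp q; exists (f x), x.
- by move=> z [x /ker -> <-].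
- move=> a q q' z z' [x <- <-] [x' <- <-].
  by exists (a *: x + x'); rewrite linearP.
exists g => x; have [x' ex <-] := gP (p x).
by apply/eqP; rewrite -subr_eq0 -linearB; apply/eqP/ker; rewrite linearB ex subrr.
Qed.

Lemma linear_inj X Y (f : {linear X -> Y}) :
  (forall x, f x = 0 -> x = 0) -> injective f.
Proof.
move=> f0 x y e; apply/eqP; rewrite -subr_eq0; apply/eqP/f0.
by rewrite linearB e subrr.
Qed.

Lemma linear_inj0 X Y (f : {linear X -> Y}) x : injective f -> f x = 0 -> x = 0.
Proof. by move=> fi e; apply: fi; rewrite e linear0. Qed.

Lemma linear_inverse X Y (f : {linear X -> Y}) : injective f -> surj f ->
  exists g : {linear Y -> X}, (forall y, f (g y) = y) /\ (forall x, g (f x) = x).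
Proof.
move=> fi fs; have [g gP] := linear_lift (f := (idfun : {linear Y -> Y})) fi fs.
by exists g; split => // x; apply: fi; rewrite gP.
Qed.

End LinearGraphs.

Section SubQuot.
Variable A : pzRingType.

Section Submodules.
Variables (M : lmodType A) (N : M -> Prop).
Hypothesis hN : is_submodule N.

Lemma submod0 : N 0. Proof. by case: hN. Qed.
Lemma submodP a x y : N x -> N y -> N (a *: x + y).
Proof. by case: hN => _; apply. Qed.
Lemma submodD x y : N x -> N y -> N (x + y).
Proof. by move=> nx ny; rewrite -[x]scale1r; apply: submodP. Qed.
Lemma submodZ a x : N x -> N (a *: x).
Proof. by move=> nx; rewrite -[_ *: _]addr0; apply: submodP => //; exact: submod0. Qed.
Lemma submodN x : N x -> N (- x).
Proof. by move=> nx; rewrite -scaleN1r; exact: submodZ. Qed.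
Lemma submodB x y : N x -> N y -> N (x - y).
Proof. by move=> nx ny; apply: submodD => //; exact: submodN. Qed.
Lemma submodDr x y : N y -> N (x + y) <-> N x.
Proof.
move=> ny; split=> h; last exact: submodD.
by rewrite -[x](addrK y); exact: submodB.
Qed.
Lemma sub_lmod : exists (K : lmodType A) (i : {linear K -> M}),
  injective i /\ forall x, N x <-> exists k, i k = x.
Proof.
pose P : {pred M} := fun x => `[< N x >].
have Pc : subsemimod_closed P.
  split; first split.
  - exact/asboolP/submod0.
  - by move=> x y /asboolP nx /asboolP ny; apply/asboolP; exact: submodD.
  - by move=> a x /asboolP nx; apply/asboolP; exact: submodZ.
pose T := {x : M | P x}.
pose K : lmodType A := HB.pack T (GRing.SubChoice_isSubLmodule.Build A M P T Pc).
pose f : K -> M := fun x => val (x : T).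
have lf : linear f by move=> a x y; rewrite /f.
exists K, (mklin lf); split; first exact: val_inj.
move=> x; split=> [nx | [k <-]].
  by exists (exist _ x (asboolT nx)).
by have := valP (k : T) => /asboolP.
Qed.

Let coset (x : M) : pred M := fun y => `[< N (x - y) >].
Let rep (x : M) : M := choose (coset x) x.

Let repP x : N (x - rep x).
Proof.
by apply/asboolP/(chooseP (P := coset x)); apply/asboolP; rewrite subrr; exact: submod0.
Qed.

Let rep_eq x y : N (x - y) -> rep x = rep y.
Proof.
move=> nxy; have e : coset x =1 coset y.
  move=> z; apply/asboolP/asboolP => h.
    have -> : y - z = (x - z) - (x - y) by rewrite opprB [RHS]addrC addrA subrK.
    exact: submodB.
  have -> : x - z = (x - y) + (y - z) by rewrite addrA subrK.
  exact: submodD.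
rewrite /rep (eq_choose e); apply: choose_id; last first.
  by apply/asboolP; rewrite subrr; exact: submod0.
by apply/asboolP; rewrite -opprB; exact: submodN.
Qed.

(** Membership in [N] is a proposition, so the carrier is a set of chosen
    representatives rather than a decidable quotient. *)
Lemma quot_lmod : exists (Q : lmodType A) (p : {linear M -> Q}),
  surj p /\ forall x, p x = 0 <-> N x.
Proof.
pose P : {pred M} := fun x => rep x == x.
pose T := {x : M | P x}.
have repK x : P (rep x).
  by apply/eqP; apply: rep_eq; rewrite -opprB; apply: submodN.
pose pi (x : M) : T := exist _ (rep x) (repK x).
have piE x y : N (x - y) -> pi x = pi y.
  by move=> h; apply: val_inj => /=; exact: rep_eq.
have piK (x : T) : pi (val x) = x.
  by apply: val_inj; exact/eqP/(valP x).
have pi_sub x : N (x - val (pi x)) by exact: repP.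
have subr_rep x y : N (y - x) -> N (x - y).
  by move=> h; rewrite -opprB; exact: submodN.
pose add (x y : T) := pi (val x + val y).
pose opp (x : T) := pi (- val x).
pose scale (a : A) (x : T) := pi (a *: val x).
have addD x y : add (pi x) (pi y) = pi (x + y).
  apply/piE/subr_rep; rewrite opprD addrACA.
  by apply: submodD; exact: pi_sub.
have scaleP a x : scale a (pi x) = pi (a *: x).
  by apply/piE/subr_rep; rewrite -scalerBr; apply: submodZ; exact: pi_sub.
have addA : associative add.
  move=> x y z; rewrite -(piK x) -(piK y) -(piK z) !addD; congr pi.
  exact: addrA.
have addC : commutative add by move=> x y; rewrite /add addrC.
have add0 : left_id (pi 0) add.
  by move=> x; rewrite -(piK x) addD add0r.
have addN : left_inverse (pi 0) opp add.
  by move=> x; rewrite -{2}(piK x) addD addNr.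
pose Z : zmodType := HB.pack T (GRing.isZmodule.Build T addA addC add0 addN).
have scA a b (x : Z) : scale a (scale b x) = scale (a * b) x.
  by rewrite -(piK x) !scaleP scalerA.
have sc1 : left_id 1 (scale : A -> Z -> Z).
  by move=> x; rewrite -(piK x) scaleP scale1r.
have scDr : right_distributive (scale : A -> Z -> Z) +%R.
  move=> a x y; rewrite -(piK x) -(piK y).
  have -> : (pi (val x) : Z) + pi (val y) = pi (val x + val y) by exact: addD.
  by rewrite !scaleP scalerDr -addD.
have scDl (x : Z) : {morph (fun a => (scale a x : Z)) : a b / a + b}.
  by move=> a b; rewrite -(piK x) !scaleP scalerDl -addD.
pose Q : lmodType A := HB.pack T Z
  (GRing.Zmodule_isLmodule.Build A Z scA sc1 scDr scDl).
have lpi : linear (pi : M -> Q).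
  by move=> a x y; rewrite -addD -scaleP.
exists Q, (mklin lpi); split; first by move=> y; exists (val (y : T)); exact: piK.
move=> x; split=> [e | nx].
  have e' : rep x = rep 0 by exact: (congr1 (fun z : T => val z) e).
  have := pi_sub 0; rewrite sub0r /= => /submodN; rewrite opprK => n0.
  by have := pi_sub x; rewrite /= e' => h; apply/(submodDr _ (submodN n0)).
by apply: piE; rewrite subr0.
Qed.

End Submodules.
End SubQuot.

Notation "X [+] Y" := (dsum_fgmod Y X) (at level 50, left associativity).

(** * Finitely generated modules *)

Section FinitelyGenerated.
Variable A : pzRingType.

Lemma fg_surj (M N : lmodType A) (f : {linear M -> N}) :
  surj f -> finitely_generated M -> finitely_generated N.
Proof.
move=> sf [n [e eP]]; exists n, (f \o e) => y.
have [x <-] := sf y; have [c ->] := eP x; exists c.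
by rewrite linear_sum; apply: eq_bigr => i _; rewrite linearZ.
Qed.

Implicit Types M N X Y Z : fgModType A.

Lemma quot_fg M (N : M -> Prop) : is_submodule N ->
  exists (Q : fgModType A) (p : {linear M -> Q}),
    surj p /\ forall x, p x = 0 <-> N x.
Proof.
move=> hN; have [Q [p [sp kp]]] := quot_lmod hN.
by exists (FgMod (fg_surj sp (fgmodP M))), p.
Qed.

Fact zero_fg : finitely_generated 'rV[A]_0.
Proof.
exists 0%N, (fun=> 0) => x; exists (fun=> 0).
by rewrite big_ord0; apply/rowP => -[].
Qed.
Definition zero_mod : fgModType A := FgMod zero_fg.

Lemma zero_modP : is_zero zero_mod.
Proof. by move=> x; apply/rowP => -[]. Qed.

Section DirectSums.
Variables X Y Z : fgModType A.
Fact copair_linear (f : {linear X -> Z}) (g : {linear Y -> Z}) :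
  linear (fun z : X [+] Y => f z.1 + g z.2).
Proof. by move=> a u v; rewrite /= !linearP scalerDr addrACA. Qed.
Definition copair f g : {linear X [+] Y -> Z} := mklin (copair_linear f g).
Fact pairing_linear (f : {linear Z -> X}) (g : {linear Z -> Y}) :
  linear (fun z => (f z, g z) : X [+] Y).
Proof. by move=> a u v; rewrite /= !linearP. Qed.
Definition pairing f g : {linear Z -> X [+] Y} := mklin (pairing_linear f g).
Fact dfst_linear : linear (fun z : X [+] Y => z.1). Proof. by []. Qed.
Definition dfst : {linear X [+] Y -> X} := mklin dfst_linear.
Fact dsnd_linear : linear (fun z : X [+] Y => z.2). Proof. by []. Qed.
Definition dsnd : {linear X [+] Y -> Y} := mklin dsnd_linear.
Fact dinl_linear : linear (fun x => (x, 0) : X [+] Y).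
Proof. by move=> a u v; rewrite /=; congr pair; rewrite /= scaler0 addr0. Qed.
Definition dinl : {linear X -> X [+] Y} := mklin dinl_linear.
Fact dinr_linear : linear (fun y => (0, y) : X [+] Y).
Proof. by move=> a u v; rewrite /=; congr pair; rewrite /= scaler0 addr0. Qed.
Definition dinr : {linear Y -> X [+] Y} := mklin dinr_linear.
End DirectSums.

Fixpoint copies M n : fgModType A :=
  if n is n'.+1 then copies M n' [+] M else zero_mod.

Definition free_mod n := copies (regular_mod A) n.

Lemma free_span M n (e : 'I_n -> M) :
  exists p : {linear free_mod n -> M},
    forall c : 'I_n -> A, exists z, p z = \sum_(i < n) c i *: e i.
Proof.
elim: n e => [|n IH] e.
  by exists \0 => c; exists 0; rewrite big_ord0.
have [p pP] := IH (fun i => e (widen_ord (leqnSn n) i)).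
have lq : linear (fun a : regular_mod A => (a : A) *: e ord_max).
  by move=> a u v; rewrite scalerDl scalerA.
exists (copair p (mklin lq)) => c.
have [z zP] := pP (fun i => c (widen_ord (leqnSn n) i)).
by exists (z, c ord_max); rewrite big_ord_recr /= zP.
Qed.

Lemma free_cover M : exists n (p : {linear free_mod n -> M}), surj p.
Proof.
have [n [e eP]] := fgmodP M; have [p pP] := free_span e.
exists n, p => x; have [c ->] := eP x; exact: pP.
Qed.

End FinitelyGenerated.
Arguments zero_mod A : clear implicits.
Arguments free_mod A n : clear implicits.
Arguments dinl {A} X Y.
Arguments dinr {A} X Y.
Arguments dfst {A} X Y.
Arguments dsnd {A} X Y.

(** * Length *)

Section Length.
Variable A : pzRingType.

(** Length at most [n], as a bound on strict chains of submodules inside [N]: in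
    this form the bound passes to submodules and images at once. *)
Fixpoint bound (M : lmodType A) n (N : M -> Prop) : Prop :=
  forall N' : M -> Prop, is_submodule N' -> (forall x, N' x -> N x) ->
    (exists2 x, N x & ~ N' x) ->
    if n is n'.+1 then bound n' N' else False.

Definition length_le (M : lmodType A) n := bound n (fun _ : M => True).

Implicit Types M : lmodType A.

Lemma bound_sub M n (N N1 : M -> Prop) :
  (forall x, N1 x -> N x) -> bound n N -> bound n N1.
Proof.
by move=> s; case: n => [|n] b N' h s' [x nx nx']; apply: (b N') => //;
  [move=> y /s'/s | exists x => //; exact: s | move=> y /s'/s | exists x => //; exact: s].
Qed.

Lemma boundS M n (N : M -> Prop) : bound n N -> bound n.+1 N.
Proof.
elim: n N => [|n IH] N b N' h s e; first by case: (b N' h s e).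
by apply: IH; exact: (b N' h s e).
Qed.

Lemma bound_leq M m n (N : M -> Prop) : (m <= n)%N -> bound m N -> bound n N.
Proof.
move=> /subnK <-; elim: (n - m)%N => // k IH b.
by rewrite addSn; apply: boundS; exact: IH.
Qed.

Lemma submod_ker M M2 (f : {linear M -> M2}) : is_submodule (fun x => f x = 0).
Proof.
split=> [|a x y fx fy]; first exact: linear0.
by rewrite linearP fx fy scaler0 addr0.
Qed.

Lemma submodI M (N K : M -> Prop) : is_submodule N -> is_submodule K ->
  is_submodule (fun x => N x /\ K x).
Proof.
move=> hN hK; split=> [|a x y [nx kx] [ny ky]].
  by split; exact: submod0.
by split; exact: submodP.
Qed.

Lemma submod_image M M2 (f : {linear M -> M2}) (N : M -> Prop) :
  is_submodule N -> is_submodule (fun y => exists2 x, N x & f x = y).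
Proof.
move=> hN; split=> [|a x y [u nu <-] [v nv <-]].
  by exists 0; [exact: submod0 | exact: linear0].
by exists (a *: u + v); [exact: submodP | rewrite linearP].
Qed.

Lemma submod_range M M2 (f : {linear M -> M2}) :
  is_submodule (fun y => exists x, f x = y).
Proof.
split=> [|a x y [u <-] [v <-]]; first by exists 0; exact: linear0.
by exists (a *: u + v); rewrite linearP.
Qed.

Lemma submod_preim M M2 (f : {linear M -> M2}) (N : M2 -> Prop) :
  is_submodule N -> is_submodule (fun x => N (f x)).
Proof.
move=> hN; split=> [|a x y nx ny]; first by rewrite linear0; exact: submod0.
by rewrite linearP; exact: submodP.
Qed.

Lemma submod_full M : is_submodule (fun _ : M => True). Proof. by []. Qed.

Lemma submod_zero M : is_submodule (fun x : M => x = 0).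
Proof. by split=> // a x y -> ->; rewrite scaler0 addr0. Qed.

(** A proper submodule of [N] becomes proper in the kernel of [f] or in the
    image of [f], so that one of the two bounds drops. *)
Lemma bound_ext M M2 (f : {linear M -> M2}) a b (N : M -> Prop) :
  is_submodule N -> bound a (fun x => N x /\ f x = 0) ->
  bound b (fun y => exists2 x, N x & f x = y) -> bound (a + b) N.
Proof.
have [k] := ubnP (a + b)%N.
elim: k a b N => // k IH a b N lek hN ba bb.
suff main N' : is_submodule N' -> (forall x, N' x -> N x) ->
    (exists2 x, N x & ~ N' x) ->
    exists2 c, (c < a + b)%N & bound c N'.
  by case E: (a + b)%N main => [|n] main N' h s e;
    have [c] := main N' h s e => //; rewrite ltnS => /bound_leq h1 /h1.
move=> hN' sN' [x0 nx0 nx0'].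
have bb' : bound b (fun y => exists2 x, N' x & f x = y).
  by apply: bound_sub bb => y [x /sN' nx <-]; exists x.
have ba' : bound a (fun x => N' x /\ f x = 0).
  by apply: bound_sub ba => x [/sN' nx fx].
have hK : is_submodule (fun x => N' x /\ f x = 0).
  by apply: submodI => //; exact: submod_ker.
have [[x [nx fx nx']]|nA] := pselect (exists x, [/\ N x, f x = 0 & ~ N' x]).
  case: a lek ba ba' => [|a] lek ba ba'.
    case: (ba _ hK); first by move=> y [/sN'].
    by exists x => // -[].
  exists (a + b)%N; first by rewrite addSn.
  apply: IH => //; apply: ba => //; first by move=> y [/sN'].
  by exists x => // -[].
have [[x nx nx']|nB] := pselect (exists2 x, N x & ~ exists2 x', N' x' & f x' = f x).
  case: b lek bb bb' => [|b] lek bb bb'.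
    case: (bb _ (submod_image f hN')); first by move=> y [z /sN' ? <-]; exists z.
    by exists (f x) => //; exists x.
  exists (a + b)%N; first by rewrite addnS.
  apply: IH => //; first by move: lek; rewrite addnS.
  apply: (bb _ (submod_image f hN')); first by move=> y [z /sN' ? <-]; exists z.
  by exists (f x) => //; exists x.
exfalso; have [[x' nx' fx]|nn] := pselect (exists2 x', N' x' & f x' = f x0); last first.
  by apply: nB; exists x0.
apply: nA; exists (x0 - x'); split.
- by apply: submodB => //; exact: sN'.
- by rewrite linearB fx subrr.
- by move/(submodDr hN' _ (submodN hN' nx')).
Qed.

Lemma bound_image M M2 (f : {linear M -> M2}) n (N : M -> Prop) :
  is_submodule N -> bound n N -> bound n (fun y => exists2 x, N x & f x = y).
Proof.
move=> hN; elim: n N hN => [|n IH] N hN b N' h s [_ [x nx <-] nx'];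
  have hI := submodI hN (submod_preim f h).
  by apply: (b _ hI) => [y []|] //; exists x => // -[].
have bI : bound n (fun x => N x /\ N' (f x)).
  by apply: (b _ hI) => [y []|] //; exists x => // -[].
apply: bound_sub (IH _ hI bI) => y n'y.
by have [z nz e] := s _ n'y; exists z => //; rewrite e.
Qed.

Lemma length_surj M M2 (f : {linear M -> M2}) n :
  surj f -> length_le M n -> length_le M2 n.
Proof.
move=> sf /(bound_image f (@submod_full M)); apply: bound_sub => y _.
by have [x <-] := sf y; exists x.
Qed.

Lemma bound0 M (N : M -> Prop) : (forall x, N x -> x = 0) -> bound 0 N.
Proof. by move=> n0 N' h _ [x /n0 -> []]; exact: submod0. Qed.

Lemma bound0P M (N : M -> Prop) : is_submodule N -> bound 0 N -> forall x, N x -> x = 0.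
Proof.
move=> hN b x nx; apply: contrapT => nx0.
by apply: (b _ (@submod_zero M)) => [y ->|]; [exact: submod0 | exists x].
Qed.

Lemma length_inj M M2 (f : {linear M -> M2}) n :
  injective f -> length_le M2 n -> length_le M n.
Proof.
move=> fi b; rewrite -[n]add0n; apply: (bound_ext (f := f)) => //.
  by apply: bound0 => x [_ /(linear_inj0 fi)].
by apply: bound_sub b.
Qed.

Lemma length_ext M M2 (f : {linear M -> M2}) a b :
  bound a (fun x => f x = 0) -> length_le M2 b -> length_le M (a + b).
Proof.
move=> ba bb; apply: (bound_ext (f := f)) => //.
  by apply: bound_sub ba => x [].
by apply: bound_sub bb.
Qed.

(** The ascending chain condition: if [k] is the least bound valid for all
    members of [P], a member that is not bounded by [k - 1] has no proper
    enlargement in [P]. *)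
Lemma bound_max M n (P : (M -> Prop) -> Prop) N0 :
  length_le M n -> (forall N, P N -> is_submodule N) -> P N0 ->
  exists2 N, P N & forall N', P N' -> (forall x, N x -> N' x) -> forall x, N' x -> N x.
Proof.
move=> bn Psub PN0.
have exk : exists k, `[< forall N, P N -> bound k N >].
  by exists n; apply/asboolP => N _; apply: bound_sub bn.
case: (ex_minnP exk) => k /asboolP bk kmin.
case: k bk kmin => [|k] bk kmin.
  exists N0 => // N' PN' _ x nx.
  by rewrite (bound0P (Psub _ PN') (bk _ PN') nx); apply: submod0; exact: Psub.
have [[N [PN nb]]|nn] := pselect (exists N, P N /\ ~ bound k N); last first.
  have /kmin : `[< forall N, P N -> bound k N >]; last by rewrite ltnn.
  by apply/asboolP => N PN; apply: contrapT => nb; apply: nn; exists N.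
exists N => // N' PN' s x nx; apply: contrapT => nx'; apply: nb.
by apply: (bk _ PN' _ (Psub _ PN)) => //; exists x.
Qed.

Lemma span_submod M n (e : 'I_n -> M) :
  is_submodule (fun x => exists c, x = \sum_i c i *: e i).
Proof.
split=> [|a x y [c ->] [d ->]].
  by exists (fun=> 0); rewrite big1 // => i _; rewrite scale0r.
exists (fun i => a * c i + d i); rewrite scaler_sumr -big_split /=.
by apply: eq_bigr => i _; rewrite scalerDl scalerA.
Qed.

(** A maximal finitely generated submodule of [N] is all of [N]. *)
Lemma noetherian_submod M n (N : M -> Prop) : length_le M n -> is_submodule N ->
  exists m (e : 'I_m -> M), forall x, N x <-> exists c, x = \sum_i c i *: e i.
Proof.
move=> bn hN.
pose P (N' : M -> Prop) := (forall x, N' x -> N x) /\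
  exists m (e : 'I_m -> M), forall x, N' x <-> exists c, x = \sum_i c i *: e i.
have [N' [s [m [e eP]]]||N1 [s1 [m [e eP]]] maxN] :=
    @bound_max M n P (fun x => x = 0) bn.
- split; first by apply/eP; exact: (span_submod e).1.
  move=> a x y /eP hx /eP hy; apply/eP; exact: (span_submod e).2.
- split=> [x ->|]; first exact: submod0.
  exists 0%N, (fun=> 0) => x; split=> [->|[c ->]]; last by rewrite big_ord0.
  by exists (fun=> 0); rewrite big_ord0.
exists m, e => x; split=> [nx|/eP/s1 //].
apply/eP.
pose e' i := oapp e x (unlift ord0 i).
have span' y : (exists c : 'I_m.+1 -> A, y = \sum_i c i *: e' i) <->
    exists a c, y = a *: x + \sum_i c i *: e i.
  split=> [[c ->]|[a [c ->]]].
    exists (c ord0), (fun i => c (lift ord0 i)); rewrite big_ord_recl /e'.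
    by rewrite unlift_none /=; congr (_ + _); apply: eq_bigr => i _; rewrite liftK.
  exists (fun i => oapp c a (unlift ord0 i)); rewrite big_ord_recl /e'.
  by rewrite unlift_none /=; congr (_ + _); apply: eq_bigr => i _; rewrite liftK.
apply: (maxN (fun y => exists c, y = \sum_i c i *: e' i)).
- split; last by exists m.+1, e'.
  move=> y /span' [a [c ->]]; apply: submodP => //; apply: s1; apply/eP.
  by exists c.
- by move=> y /eP [c ->]; apply/span'; exists 0, c; rewrite scale0r add0r.
- by apply/span'; exists 1, (fun=> 0); rewrite scale1r big1 ?addr0 // => i _; rewrite scale0r.
Qed.

Lemma noetherian_fg M n : length_le M n -> finitely_generated M.
Proof.
move=> bn; have [m [e eP]] := noetherian_submod bn (@submod_full M).
by exists m, e => x; apply/eP.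
Qed.

Definition finite_length_ring := forall M : fgModType A, exists n, length_le M n.

Lemma length_copies (M : fgModType A) n k : length_le M k -> length_le (copies M n) (n * k).
Proof.
move=> bk; elim: n => [|n IH]; first by apply: bound0 => x _; exact: zero_modP.
rewrite mulSn addnC; apply: (length_ext (f := dsnd (copies M n) M)) => //.
apply: bound_sub (bound_image (dinl (copies M n) M) (@submod_full _) IH).
by move=> [x y] /= ->; exists x.
Qed.

Lemma finite_length_regular k : length_le A^o k -> finite_length_ring.
Proof.
move=> bk M; have [n [p sp]] := free_cover M.
by exists (n * k)%N; apply: length_surj sp _; exact: (@length_copies (regular_mod A)).
Qed.

Lemma sub_fg (M : fgModType A) (N : M -> Prop) : finite_length_ring -> is_submodule N ->
  exists (K : fgModType A) (i : {linear K -> M}),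
    injective i /\ forall x, N x <-> exists k, i k = x.
Proof.
move=> fl hN; have [n bn] := fl M; have [K [i [ii iP]]] := sub_lmod hN.
by exists (FgMod (noetherian_fg (length_inj ii bn))), i.
Qed.

End Length.

(** * Commutative artinian rings have finite length *)

Section Akizuki.

Lemma submod_add1 (A : pzRingType) (M : lmodType A) (N : M -> Prop) (z : M) :
  is_submodule N -> is_submodule (fun x => exists a u, N u /\ x = a *: z + u).
Proof.
move=> hN; split=> [|c x y [a [u [nu ->]]] [b [v [nv ->]]]].
  by exists 0, 0; rewrite scale0r addr0; split=> //; exact: submod0.
exists (c * a + b), (c *: u + v); split; first exact: submodP.
by rewrite scalerDr scalerDl scalerA addrACA.
Qed.

(** By Zorn's lemma; maximality says that every element outside [U] generates
    [y] modulo [U]. *)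
Lemma maximal_avoiding (A : pzRingType) (M : lmodType A) (L : M -> Prop) (y : M) :
  is_submodule L -> ~ L y ->
  exists U : M -> Prop, [/\ is_submodule U, forall x, L x -> U x, ~ U y &
    forall z, ~ U z -> exists a u, U u /\ y = a *: z + u].
Proof.
move=> hL ny.
pose P (U : M -> Prop) := [/\ is_submodule U, forall x, L x -> U x & ~ U y].
pose T := {U | P U}.
have PL : P L by [].
pose r (U V : T) := `[< forall x, sval U x -> sval V x >].
have [|||[U [hU LU nU]] Umax] := @ZL_preorder T (exist P L PL) r.
- by move=> U; apply/asboolP.
- move=> U V W /asboolP VU /asboolP UW; apply/asboolP => x /VU; exact: UW.
- move=> C totC.
  have [[V0 CV0]|C0] := pselect (exists V, C V); last first.
    by exists (exist P L PL) => V CV; case: C0; exists V.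
  pose W x := exists2 V, C V & sval V x.
  have hW : is_submodule W.
    split=> [|a x x' [V CV Vx] [V' CV' Vx']].
      by exists V0 => //; case: (svalP V0) => h _ _; exact: submod0.
    case: (totC _ _ CV CV') => /asboolP s.
      by exists V' => //; case: (svalP V') => h _ _; apply: submodP => //; exact: s.
    by exists V => //; case: (svalP V) => h _ _; apply: submodP => //; exact: s.
  have PW : P W.
    split=> // [x lx|[V CV]]; last by case: (svalP V).
    by exists V0 => //; case: (svalP V0) => _ + _; apply.
  exists (exist P W PW) => V CV; apply/asboolP => x Vx; by exists V.
exists U; split=> // z nz; apply: contrapT => nn.
pose V x := exists a u, U u /\ x = a *: z + u.
have PV : P V.
  split; first exact: submod_add1.
    by move=> x /LU ux; exists 0, x; rewrite scale0r add0r.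
  by move=> [a [u [uu e]]]; apply: nn; exists a, u.
have /asboolP/= := Umax (exist P V PV) (ltac:(apply/asboolP => x ux /=; exists 0, x; rewrite scale0r add0r; by split)).
move=> /(_ z) h; apply: nz; apply: h; exists 1, 0; rewrite scale1r addr0.
by split=> //; exact: submod0.
Qed.

Variable R : comPzRingType.
Hypothesis hR : artinian R.

Lemma artinian_min (P : (R^o -> Prop) -> Prop) J0 :
  (forall J, P J -> is_submodule J) -> P J0 ->
  exists2 J, P J & forall J', P J' -> (forall x, J' x -> J x) -> forall x, J x -> J' x.
Proof.
move=> Psub PJ0; apply: contrapT => nmin.
pose T := {J | P J}.
have step (J : T) : exists J' : T,
    (forall x, sval J' x -> sval J x) /\ ~ (forall x, sval J x -> sval J' x).
  apply: contrapT => nJ; apply: nmin; exists (sval J); first exact: svalP.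
  move=> J' PJ' s; apply: contrapT => n; apply: nJ.
  by exists (exist P J' PJ').
have [f fP] := choice step.
pose s n := iter n f (exist P J0 PJ0).
have [|n x|N hN] := hR (J := fun n => sval (s n)).
- by move=> n; apply: Psub; exact: svalP.
- by case: (fP (s n)) => + _; apply.
by case: (fP (s N)) => _; apply; apply: hN (leqnSn N).
Qed.

Let quotient_length (J : R^o -> Prop) n := exists (Q : lmodType R) (p : {linear R^o -> Q}),
  [/\ surj p, forall x, p x = 0 <-> J x & length_le Q n].

Let finite_colength J := is_submodule J /\ exists n, quotient_length J n.

(* The product ideal, as an intersection, which spares finite sums. *)
Let prod_ideal (I J : R^o -> Prop) (x : R^o) := forall N : R^o -> Prop, is_submodule N ->
  (forall a b : R, I a -> J b -> N (a * b)) -> N x.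

Let prod_ideal_submod I J : is_submodule (prod_ideal I J).
Proof.
split=> [N hN _|a x y px py N hN hIJ]; first exact: submod0.
by apply: submodP => //; [exact: px | exact: py].
Qed.

(** For an ideal [p] the last hypothesis says that [R / p] is a field or zero. If
    [y] were in [J] but not in [p J], take [V] between [p J] and [J] maximal
    without [y]: then [J / V] is simple, so that [V] has finite colength, against
    the minimality of [J]. *)
Let minimal_colength J p : finite_colength J ->
  (forall J', finite_colength J' -> (forall x, J' x -> J x) -> forall x, J x -> J' x) ->
  (forall r : R, ~ p r -> exists s : R, p (1 - s * r)) ->
  forall y, J y -> prod_ideal p J y.
Proof.
move=> [hJ [n [Q [pi [spi kpi bQ]]]]] Jmin pfield y Jy; apply: contrapT => npy.
have [U [hU pU nUy Umax]] := maximal_avoiding (prod_ideal_submod p J) npy.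
pose V x := U x /\ J x.
have hV : is_submodule V by exact: submodI.
have pJU a b : p a -> J b -> U (a * b) by move=> pa Jb; apply: pU => N _; apply.
have [Q' [pi' [spi' kpi']]] := quot_lmod hV.
have [f fP] : exists f : {linear Q' -> Q}, forall x, f (pi' x) = pi x.
  by apply: linear_factor => // x /kpi' [_ /kpi].
(* J / V is simple: it is generated by any z in J outside U *)
have gen z : J z -> ~ U z -> forall w, J w -> exists a, pi' w = a *: pi' z.
  have Jgen z' : J z' -> ~ U z' -> exists b, pi' z' = b *: pi' y.
    move=> Jz nUz; have [a [u [Uu ye]]] := Umax _ nUz.
    have [pa|/pfield [s ps]] := pselect (p a).
      case: nUy; rewrite ye; apply: submodD => //; exact: pJU.
    exists s; apply/eqP; rewrite -subr_eq0 -linearZ -linearB; apply/eqP/kpi'.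
    have e : z' - s *: y = (1 - s * a) * z' - s *: u.
      by rewrite ye scalerDr scalerA mulrBl mul1r opprD addrA.
    split; last by apply: submodB => //; exact: submodZ.
    rewrite e; apply: (submodB hU); last exact: submodZ.
    exact: pJU.
  move=> Jz nUz w Jw; have [Uw|nUw] := pselect (U w).
    exists 0; rewrite scale0r; exact/kpi'.
  have [b ->] := Jgen _ Jw nUw.
  have [a [u [Uu ye]]] := Umax _ nUz.
  exists (b * a); rewrite -scalerA; congr (_ *: _).
  apply/eqP; rewrite -linearZ -subr_eq0 -linearB; apply/eqP/kpi'.
  split; first by rewrite ye addrAC subrr add0r.
  by apply: (submodB hJ) => //; exact: submodZ.
have bker : bound 1 (fun q => f q = 0).
  move=> N hN sN [q fq nq]; apply: bound0 => q1 nq1; apply: contrapT => q10.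
  have [z ez] := spi' q1; have [w ew] := spi' q; apply: nq.
  have [|||a wa] := @gen z _ _ w.
  - by apply/kpi; rewrite -fP ez; exact: sN.
  - by move=> Uz; apply: q10; rewrite -ez; apply/kpi'; split => //; apply/kpi; rewrite -fP ez; exact: sN.
  - by apply/kpi; rewrite -fP ew.
  by rewrite -ew wa ez; exact: submodZ.
have /Jmin/(_ _ y Jy) [|//] : finite_colength V; last by move=> x [].
by split=> //; exists (1 + n)%N, Q', pi'; split=> //; exact: length_ext bker bQ.
Qed.

(** The theorem of Akizuki. Let [J] be minimal among the ideals of finite
    colength, and suppose [J] is not zero. Take [I] minimal among the ideals with
    [I J <> 0]; then [I] is generated by some [x], and the annihilator [p] of
    [x J] is a maximal ideal. As [J = p J], this gives [x J = x p J = 0], a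
    contradiction. *)
Lemma artinian_length : exists n, length_le R^o n.
Proof.
have [||J [hJ fJ] Jmin] := @artinian_min finite_colength (fun=> True).
- by move=> J [].
- split=> //; exists 0%N; have [Q [pi [spi kpi]]] := quot_lmod (@submod_full R R^o).
  exists Q, pi; split => //; apply: bound0 => q _.
  by have [x <-] := spi q; apply/kpi.
have [n [Q [pi [spi kpi bQ]]]] := fJ; exists n.
apply: (length_inj (f := pi)) bQ; apply: linear_inj => z /kpi Jz.
apply: contrapT => z0.
pose P (I : R^o -> Prop) := is_submodule I /\ exists a b : R, [/\ I a, J b & a * b <> 0].
have [||I [hI [x [b [Ix Jb xb0]]]] Imin] := @artinian_min P (fun=> True).
- by move=> I [].
- by split=> //; exists 1, z; rewrite mul1r.
have multiples (y : R^o) : is_submodule (fun w : R^o => exists a : R, w = a *: y).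
  split=> [|a u v [c ->] [d ->]]; first by exists 0; rewrite scale0r.
  by exists (a * c + d); rewrite scalerDl scalerA.
pose p (r : R^o) := forall c : R, J c -> r * x * c = 0.
have hp : is_submodule p.
  split=> [c _|a r s pr ps c Jc]; first by rewrite !mul0r.
  by rewrite !mulrDl ps // -[a *: r]/(a * r) -!mulrA (mulrA r) pr // mulr0 addr0.
have pfield r : ~ p r -> exists s : R, p (1 - s * r).
  move=> npr; have [c [Jc rc]] : exists c, J c /\ r * x * c <> 0.
    by apply: contrapT => nn; apply: npr => c Jc; apply: contrapT => ne; apply: nn; exists c.
  have [||s xs] := Imin (fun w : R^o => exists a : R, w = a *: (r * x)) _ _ x Ix.
  - by split; [exact: multiples | exists (r * x), c; split=> //; exists 1; rewrite scale1r].
  - by move=> _ [a ->]; apply: submodZ => //; exact: (@submodZ _ _ _ hI r x Ix).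
  exists s => d Jd; rewrite mulrBl mul1r -mulrA -[s * _]/(s *: (r * x : R^o)) -xs.
  by rewrite subrr mul0r.
apply: xb0; apply: (minimal_colength (p := p) (conj hJ fJ) Jmin pfield Jb
  (N := fun y : R^o => x * y = 0)).
  split=> [|a u v xu xv]; first by rewrite mulr0.
  by rewrite mulrDr xv -[a *: u]/(a * u) mulrCA xu mulr0 addr0.
by move=> a c pa Jc; rewrite mulrA (mulrC x) pa.
Qed.

Lemma artinian_finite_length : finite_length_ring R.
Proof. by have [n bn] := artinian_length; exact: finite_length_regular bn. Qed.

End Akizuki.

(** * Simple modules, pushouts and essential extensions *)

Section Schur.
Variable A : pzRingType.
Implicit Types S T X Y Z M : fgModType A.

Lemma simple_generated T (t : T) : simple T -> t <> 0 -> forall x, exists a : A, x = a *: t.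
Proof.
move=> [_ sT] t0; have [|z0|//] := sT (fun x => exists a : A, x = a *: t).
  split=> [|a x y [c ->] [d ->]]; first by exists 0; rewrite scale0r.
  by exists (a * c + d); rewrite scalerDl scalerA.
by case: t0; apply: z0; exists 1; rewrite scale1r.
Qed.

Lemma simple_inj T Y (f : {linear T -> Y}) : simple T -> (exists t, f t <> 0) -> injective f.
Proof.
move=> [_ sT] [t ft]; apply: linear_inj.
by case: (sT _ (submod_ker f)) => // z; case: ft.
Qed.

Lemma simple_surj X T (f : {linear X -> T}) : simple T -> (exists x, f x <> 0) -> surj f.
Proof.
move=> [_ sT] [x fx]; case: (sT _ (submod_range f)) => // z.
by case: fx; apply: z; exists x.
Qed.

Lemma pushout X Y M (f : {linear X -> Y}) (g : {linear X -> M}) :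
  exists (Z : fgModType A) (u : {linear M -> Z}) (v : {linear Y -> Z}),
    [/\ forall x, u (g x) = v (f x),
        forall m y, u m + v y = 0 -> exists x, m = g x /\ y = - f x &
        forall z, exists m y, z = u m + v y].
Proof.
have [Q [p [sp kp]]] := quot_fg (submod_range (pairing g (\- f))).
exists Q, (p \o dinl M Y), (p \o dinr M Y).
have pE m y : p (m, 0) + p (0, y) = p (m, y).
  by rewrite -linearD; congr (p (_, _)); rewrite /= ?addr0 ?add0r.
split=> [x|m y|z].
- rewrite /=; apply/eqP; rewrite -subr_eq0 -linearB; apply/eqP/kp; exists x.
  by congr pair; rewrite /= ?subr0 ?sub0r.
- by rewrite /= pE => /kp [x [<- <-]]; exists x.
- by have [[m y] <-] := sp z; exists m, y; rewrite /= pE.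
Qed.

Definition essential M Y (u : {linear M -> Y}) := injective u /\
  forall N : Y -> Prop, is_submodule N -> (exists2 y, N y & y <> 0) ->
    exists2 m, N (u m) & u m <> 0.

(** To extend [g : X -> M] along a monomorphism [X -> Y], form the pushout [Z]
    and divide it by a submodule maximal among those meeting [M] trivially: the
    quotient is an essential extension of [M], hence [M] itself, and this
    retracts [Z] onto [M]. *)
Lemma essential_injective M : finite_length_ring A ->
  (forall Y (u : {linear M -> Y}), essential u -> surj u) -> injective_module M.
Proof.
move=> fl noess X Y f g fi.
have [Z [u [v [uv kuv _]]]] := pushout f g.
have ui : injective u.
  apply: linear_inj => m um; have [|x [-> /esym/eqP]] := kuv m 0.
    by rewrite um linear0 addr0.
  by rewrite oppr_eq0 => /eqP /(linear_inj0 fi) ->; rewrite linear0.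
have [n bZ] := fl Z.
pose P (N : Z -> Prop) := is_submodule N /\ forall m, N (u m) -> m = 0.
have [||N [hN Nu] Nmax] := @bound_max _ Z n P (fun z => z = 0) bZ.
- by move=> N [].
- by split=> [|m /(linear_inj0 ui)]; first exact: submod_zero.
have [Q [p [sp kp]]] := quot_fg hN.
have pui : injective (p \o u : {linear M -> Q}).
  by apply: linear_inj => m /= /kp /Nu.
have [|k [kr kl]] := linear_inverse pui.
  apply: noess; split=> // N' hN' [q n'q q0].
  have hpre := submod_preim p hN'.
  apply: contrapT => nn.
  have : forall z, N' (p z) -> N z.
    apply: (Nmax (fun z => N' (p z))) => [|z /kp ->]; last exact: submod0.
    split=> // m n'm; apply: (linear_inj0 pui); apply: contrapT => pum.
    by apply: nn; exists m.
  by have [z ez] := sp q => /(_ z); rewrite ez => /(_ n'q) /kp; rewrite ez.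
exists (k \o (p \o v)) => x.
by rewrite /= -uv; exact: kl.
Qed.

End Schur.

Lemma length_range (A : pzRingType) (M M2 : lmodType A) (f : {linear M -> M2}) n :
  injective f -> bound n (fun y => exists x, f x = y) -> length_le M n.
Proof.
move=> fi b; rewrite -[n]add0n; apply: (bound_ext (f := f)) => //.
  by apply: bound0 => x [_ /(linear_inj0 fi)].
by apply: bound_sub b => y [x _ <-]; exists x.
Qed.

(** * Modules of homomorphisms *)

Definition antimorphism (A A' : pzRingType) (tau : A' -> A) :=
  [/\ tau 1 = 1, forall a b, tau (a + b) = tau a + tau b &
      forall a b, tau (a * b) = tau b * tau a].

Definition central (R A : pzRingType) (rho : R -> A) := forall r a, rho r * a = a * rho r.

Section HomModule.
Variables (R A A' : pzRingType) (rho : {rmorphism R -> A}) (tau : A' -> A).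
Hypotheses (hrho : central rho) (htau : antimorphism tau).
Variables (E : lmodType R).

(** The [R]-linear maps from [M] to [E], where [R] acts on [M] through [rho];
    [A'] acts on them through [tau]. For [A = A' = R] this is the usual module of
    homomorphisms. *)
Record hom (M : lmodType A) := MkHom {
  hom_fun :> M -> E;
  homP : forall r x y, hom_fun (rho r *: x + y) = r *: hom_fun x + hom_fun y }.

Section Objects.
Variable M : lmodType A.
Implicit Types f g h : hom M.

Lemma hom_ext f g : f =1 g -> f = g.
Proof.
by case: f g => [f fP] [g gP] /= /funext e; subst g; congr MkHom; exact: Prop_irrelevance.
Qed.

Lemma homD f x y : f (x + y) = f x + f y.
Proof. by have := homP f 1 x y; rewrite rmorph1 !scale1r. Qed.
Lemma hom0 f : f 0 = 0.
Proof. by apply: (addrI (f 0)); rewrite -homD !addr0. Qed.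
Lemma homZ f r x : f (rho r *: x) = r *: f x.
Proof. by have := homP f r x 0; rewrite hom0 !addr0. Qed.

Fact hom_add_proof f g r x y :
  (f (rho r *: x + y) + g (rho r *: x + y)) = r *: (f x + g x) + (f y + g y).
Proof. by rewrite !homP scalerDr addrACA. Qed.
Fact hom_opp_proof f r x y : - f (rho r *: x + y) = r *: (- f x) + (- f y).
Proof. by rewrite homP opprD scalerN. Qed.
Fact hom_zero_proof r (x y : M) : 0 = r *: 0 + 0 :> E.
Proof. by rewrite scaler0 addr0. Qed.
Fact hom_scale_proof (a : A') f r x y :
  f (tau a *: (rho r *: x + y)) = r *: f (tau a *: x) + f (tau a *: y).
Proof. by rewrite scalerDr scalerA -hrho -scalerA homP. Qed.

Definition hom_add f g := MkHom (hom_add_proof f g).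
Definition hom_opp f := MkHom (hom_opp_proof f).
Definition hom_zero : hom M := MkHom hom_zero_proof.
Definition hom_scale a f := MkHom (hom_scale_proof a f).

HB.instance Definition _ := gen_eqMixin (hom M).
HB.instance Definition _ := gen_choiceMixin (hom M).
Fact hom_addA : associative hom_add.
Proof. by move=> f g h; apply: hom_ext => x; exact: addrA. Qed.
Fact hom_addC : commutative hom_add.
Proof. by move=> f g; apply: hom_ext => x; exact: addrC. Qed.
Fact hom_add0 : left_id hom_zero hom_add.
Proof. by move=> f; apply: hom_ext => x; exact: add0r. Qed.
Fact hom_addN : left_inverse hom_zero hom_opp hom_add.
Proof. by move=> f; apply: hom_ext => x; exact: addNr. Qed.
HB.instance Definition _ := GRing.isZmodule.Build (hom M) hom_addA hom_addC hom_add0 hom_addN.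

Fact hom_scaleA a b (f : hom M) : hom_scale a (hom_scale b f) = hom_scale (a * b) f.
Proof. by case: htau => _ _ tM; apply: hom_ext => x; rewrite /= tM scalerA. Qed.
Fact hom_scale1 : left_id 1 (hom_scale : A' -> hom M -> hom M).
Proof. by case: htau => t1 _ _ f; apply: hom_ext => x; rewrite /= t1 scale1r. Qed.
Fact hom_scaleDr : right_distributive (hom_scale : A' -> hom M -> hom M) +%R.
Proof. by move=> a f g; apply: hom_ext. Qed.
Fact hom_scaleDl (f : hom M) : {morph (hom_scale^~ f : A' -> hom M) : a b / a + b}.
Proof. by case: htau => _ tD _ a b; apply: hom_ext => x; rewrite /= tD scalerDl homD. Qed.

Definition hom_mod : lmodType A' := HB.pack (hom M)
  (GRing.Zmodule_isLmodule.Build A' (hom M) hom_scaleA hom_scale1 hom_scaleDr hom_scaleDl).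

End Objects.

Section Morphisms.
Variables (M N : lmodType A) (u : {linear M -> N}).
Fact hom_map_proof (f : hom N) r x y : f (u (rho r *: x + y)) = r *: f (u x) + f (u y).
Proof. by rewrite linearP homP. Qed.
Definition hom_map_fun (f : hom_mod N) : hom_mod M := MkHom (hom_map_proof f).
Fact hom_map_linear : linear hom_map_fun.
Proof. by move=> a f g; apply: hom_ext => x /=; rewrite /= linearZ. Qed.
Definition hom_map : {linear hom_mod N -> hom_mod M} := mklin hom_map_linear.
End Morphisms.

End HomModule.

(** * A finitely generated dualizing module *)

Section Dualizing.
Variable R : comPzRingType.
Hypothesis hR : artinian R.

Let flR : finite_length_ring R := artinian_finite_length hR.

Fact central_id : central (idfun : R -> R). Proof. by move=> r a; rewrite mulrC. Qed.
Fact antimorphism_id : antimorphism (idfun : R -> R).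
Proof. by split=> // a b; rewrite mulrC. Qed.

Definition homR (E M : lmodType R) : lmodType R :=
  hom_mod (rho := (idfun : {rmorphism R -> R})) central_id antimorphism_id E M.

Definition homR_of (E M : lmodType R) (f : {linear M -> E}) : homR E M :=
  @MkHom R R (idfun : {rmorphism R -> R}) E M f (fun r x y => linearP f r x y).
Definition homR_lin (E M : lmodType R) (f : homR E M) : {linear M -> E} :=
  @mklin R M E f (fun r x y => homP f r x y).

(** Every simple module occurs at most once in the socle of [E]. *)
Definition multiplicity_free (E : fgModType R) :=
  forall (T : fgModType R) (f g : {linear T -> E}), simple T ->
    (exists t, f t <> 0) -> exists r : R, forall t, g t = r *: f t.

Lemma maximal_submodule (A : pzRingType) (Q : lmodType A) n : length_le Q n ->
  (exists x : Q, x <> 0) ->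
  exists N : Q -> Prop, [/\ is_submodule N, exists x, ~ N x &
    forall N', is_submodule N' -> (forall x, N x -> N' x) -> (exists x, ~ N' x) ->
      forall x, N' x -> N x].
Proof.
move=> bQ [x0 nx0].
pose P (N : Q -> Prop) := is_submodule N /\ exists x, ~ N x.
have [||N [hN pN] Nmax] := @bound_max _ Q n P (fun x => x = 0) bQ.
- by move=> N [].
- by split; [exact: submod_zero | exists x0].
by exists N; split=> // N' hN' s p; apply: Nmax.
Qed.

Lemma quot_simple (A : pzRingType) (Q T : fgModType A) (p : {linear Q -> T}) (N : Q -> Prop) :
  surj p -> (forall x, p x = 0 <-> N x) -> (exists x, ~ N x) ->
  (forall N', is_submodule N' -> (forall x, N x -> N' x) -> (exists x, ~ N' x) ->
      forall x, N' x -> N x) -> simple T.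
Proof.
move=> sp kp [x0 nx0] Nmax; split; first by exists (p x0) => /kp.
move=> N' hN'; have [all|nall] := pselect (forall x, N' (p x)).
  by right=> y; have [x <-] := sp y.
left=> y; have [x <-] := sp y => nx; apply/kp; move: x nx.
apply: (Nmax (fun x => N' (p x))); first exact: submod_preim.
  by move=> x /kp ->; exact: submod0.
by apply: contrapT => nn; apply: nall => x; apply: contrapT => h; apply: nn; exists x.
Qed.

(** Passing from a maximal submodule [N] of [Q] to [Q] adds to [Hom(Q, E)] at
    most [Hom(Q / N, E)], which has length at most one because [Q / N] is simple. *)
Lemma length_hom (E : fgModType R) : multiplicity_free E ->
  forall n (Q : fgModType R), length_le Q n -> length_le (homR E Q) n.
Proof.
move=> mE; elim=> [|n IH] Q bQ.
  apply: bound0 => f _; apply: hom_ext => x.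
  by rewrite (@bound0P _ Q _ (@submod_full _ Q) bQ x I) (hom0 f).
have [Q0|Qn0] := pselect (exists x : Q, x <> 0); last first.
  apply: (bound_leq (leq0n n.+1)); apply: bound0 => f _; apply: hom_ext => x.
  suff -> : x = 0 by rewrite (hom0 f).
  by apply: contrapT => nx; apply: Qn0; exists x.
have [N [hN [x0 nx0] Nmax]] := maximal_submodule bQ Q0.
have [K [i [ii iP]]] := sub_fg flR hN.
have [T [p [sp kp]]] := quot_fg hN.
have sT : simple T by apply: quot_simple sp kp _ Nmax; exists x0.
have bK : length_le K n.
  apply: length_range ii _; apply: (@bound_sub _ _ _ N); first by move=> y /iP.
  by apply: bQ => //; exists x0.
rewrite -add1n.
apply: (length_ext (f := hom_map central_id antimorphism_id E i)); last exact: IH.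
have fact f : hom_map central_id antimorphism_id E i f = 0 ->
    exists f' : {linear T -> E}, forall x, f' (p x) = f x.
  move=> f0; apply: (linear_factor (f := homR_lin f)) => // x /kp /iP [k <-].
  exact: (congr1 (fun h : homR E K => h k) f0).
move=> N' hN' sN [f f0 nf]; apply: bound0 => g ng; apply: contrapT => g0; apply: nf.
have [f' f'P] := fact f f0; have [g' g'P] := fact g (sN g ng).
have [|r rP] := mE T g' f' sT.
  apply: contrapT => nn; apply: g0; apply: hom_ext => x; rewrite -g'P.
  by apply: contrapT => gx; apply: nn; exists (p x).
suff -> : f = r *: g by apply: (submodZ hN').
apply: hom_ext => x; rewrite -f'P rP g'P.
by apply/esym; exact: (homZ g r x).
Qed.

(** A multiplicity free [E] is [Hom(R, E)], hence no longer than [R]. *)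
Lemma multiplicity_free_length : exists n, forall E, multiplicity_free E -> length_le E n.
Proof.
have [n bn] := flR (regular_mod R); exists n => E mE.
have lev : linear (fun f : homR E (regular_mod R) => f (1 : R)).
  by move=> a f g; congr (_ + _); exact: (homZ f a (1 : R^o)).
apply: (length_surj (f := mklin lev)) (length_hom mE bn) => x.
by exists (homR_of (mklin (@orbit_map_linear R E x))); rewrite /= /orbit_map scale1r.
Qed.

Lemma scalerC (M : lmodType R) (a b : R) (x : M) : a *: (b *: x) = b *: (a *: x).
Proof. by rewrite !scalerA mulrC. Qed.

(** The length bound allows one to take [E] of maximal length among the
    multiplicity free modules. The simple submodules of an essential extension of
    [E] lie in [E], so that the extension is multiplicity free again and hence
    trivial: [E] is injective. A simple module without nonzero map to [E] could be
    added to [E] as a direct summand, so there is none. *)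
Lemma dualizing_exists : exists E : fgModType R,
  [/\ multiplicity_free E, injective_module E &
      forall T : fgModType R, simple T -> exists f : {linear T -> E}, exists t, f t <> 0].
Proof.
have [E mE Emax] : exists2 E, multiplicity_free E &
    forall (Y : fgModType R) (u : {linear E -> Y}), multiplicity_free Y -> injective u -> surj u.
  have exk : exists k, `[< forall E, multiplicity_free E -> length_le E k >].
    by have [n bn] := multiplicity_free_length; exists n; apply/asboolP.
  case: (ex_minnP exk) => k /asboolP bk kmin.
  have [E [mE nE]] : exists E, multiplicity_free E /\
      forall k', k = k'.+1 -> ~ length_le E k'.
    case: k bk kmin => [|k] bk kmin.
      by exists (zero_mod R); split=> // T f g _ [t []]; exact: zero_modP.
    apply: contrapT => nn; suff : (k < k)%N by rewrite ltnn.
    apply: kmin; apply/asboolP => E mE; apply: contrapT => nE; apply: nn.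
    by exists E; split=> // k' [<-].
  exists E => // Y u mY ui y; apply: contrapT => ny.
  case: k bk kmin nE => [|k] bk kmin nE;
    have b := bk _ mY _ (submod_range u) (fun _ _ => I) (ex_intro2 _ _ y I ny) => //.
  by apply: (nE k) => //; exact: length_range ui b.
exists E; split=> //.
  apply: essential_injective => // Y u [ui uess]; apply: Emax => // T f g sT fn0.
  have lands (h : {linear T -> Y}) t : exists e, u e = h t.
    have [[t0 ht0]|nn] := pselect (exists t, h t <> 0); last first.
      exists 0; rewrite linear0; apply: contrapT => ht.
      by apply: nn; exists t => e; apply: ht.
    have [|e [t1 ht1] ue] := uess _ (submod_range h).
      by exists (h t0) => //; exists t0.
    have [_ sT'] := sT.
    case: (sT' _ (submod_preim h (submod_range u))) => [z|]; last exact.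
    by case: ue; rewrite -ht1 (z t1) ?linear0 //; exists e.
  have [f' f'P] := linear_lift ui (lands f); have [g' g'P] := linear_lift ui (lands g).
  have [|r rP] := mE T f' g' sT.
    by have [t ft] := fn0; exists t => f't; apply: ft; rewrite -f'P f't linear0.
  by exists r => t; rewrite -g'P rP linearZ f'P.
move=> T sT; apply: contrapT => nf.
have hT0 (h : {linear T -> E}) t : h t = 0.
  by apply: contrapT => ht; apply: nf; exists h, t.
have [t0 nt0] := sT.1.
suff mET : multiplicity_free (E [+] T).
  have [|e] := Emax _ (dinl E T) mET _ (0, t0); first by move=> x y [].
  by move=> [_ e0]; apply: nt0.
move=> T' f g sT' fn0.
have [[h [t1 ht1]]|nh] := pselect (exists h : {linear T' -> T}, exists t, h t <> 0); last first.
  have z (k : {linear T' -> E [+] T}) t : (k t).2 = 0.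
    by apply: contrapT => kt; apply: nh; exists (dsnd E T \o k), t.
  have [|r rP] := mE T' (dfst E T \o f) (dfst E T \o g) sT'.
    have [t ft] := fn0; exists t => /= ft1; apply: ft.
    by rewrite [f t]surjective_pairing ft1 z.
  exists r => t; rewrite [g t]surjective_pairing [f t]surjective_pairing !z.
  by have /= -> := rP t; congr pair; rewrite /= scaler0.
have hn : exists t, h t <> 0 by exists t1.
have [k [_ kh]] := linear_inverse (simple_inj sT' hn) (simple_surj sT hn).
have z (l : {linear T' -> E [+] T}) t : (l t).1 = 0.
  by rewrite -(kh t); exact: (hT0 (dfst E T \o l \o k)).
have [t ft] := fn0.
have ft2 : (f t).2 <> 0.
  by move=> e; apply: ft; rewrite [f t]surjective_pairing e z.
have t0' : t <> 0 by move=> e; apply: ft; rewrite e linear0.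
have [r rP] := simple_generated sT ft2 (g t).2.
have gt : g t = r *: f t.
  rewrite [g t]surjective_pairing [f t]surjective_pairing !z rP.
  by congr pair; rewrite /= scaler0.
exists r => x; have [a ->] := simple_generated sT' t0' x.
by rewrite (linearZZ g) (linearZZ f) gt scalerC.
Qed.

End Dualizing.

(** * Restriction of scalars *)

(** The morphism occurs in the type so that it determines the scaling. *)
Definition restr (A B : pzRingType) (f : {rmorphism A -> B}) (N : lmodType B) : Type := N.
HB.instance Definition _ (A B : pzRingType) (f : {rmorphism A -> B}) (N : lmodType B) :=
  GRing.Zmodule.copy (restr f N) N.

Section Restriction.
Variables (A B : pzRingType) (f : {rmorphism A -> B}).
Local Notation restr := (restr f).

Section Scale.
Variable N : lmodType B.
Definition restr_scale (a : A) (x : restr N) : restr N := f a *: (x : N).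
Fact restr_scaleA a b x : restr_scale a (restr_scale b x) = restr_scale (a * b) x.
Proof. by rewrite /restr_scale scalerA rmorphM. Qed.
Fact restr_scale1 : left_id 1 restr_scale.
Proof. by move=> x; rewrite /restr_scale rmorph1 scale1r. Qed.
Fact restr_scaleDr : right_distributive restr_scale +%R.
Proof. by move=> a x y; exact: scalerDr. Qed.
Fact restr_scaleDl x : {morph restr_scale^~ x : a b / a + b}.
Proof. by move=> a b; rewrite /restr_scale rmorphD scalerDl. Qed.
HB.instance Definition _ := GRing.Zmodule_isLmodule.Build A (restr N)
  restr_scaleA restr_scale1 restr_scaleDr restr_scaleDl.
End Scale.

Fact restr_map_linear (M N : lmodType B) (u : {linear M -> N}) :
  linear (u : restr M -> restr N).
Proof. by move=> a x y; exact: linearP. Qed.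
Definition restr_map (M N : lmodType B) (u : {linear M -> N}) :
  {linear restr M -> restr N} := mklin (restr_map_linear u).

Lemma restr_fg (M : fgModType B) :
  finitely_generated (restr B^o) -> finitely_generated (restr M).
Proof.
move=> fgB; have [n [p sp]] := free_cover M.
apply: (fg_surj (f := restr_map p)) => //.
elim: n {p sp} => [|n IH].
  exists 0%N, (fun=> 0) => x; exists (fun=> 0); rewrite big_ord0.
  exact: (zero_modP x).
pose X : fgModType A := FgMod IH.
pose Y : fgModType A := FgMod fgB.
have lid : linear (id : X [+] Y -> restr (free_mod B n.+1)) by [].
by apply: (fg_surj (f := mklin lid)) (fgmodP (X [+] Y)) => z; exists z.
Qed.

Lemma length_restr (N : lmodType B) n : length_le (restr N) n -> length_le N n.
Proof.
rewrite /length_le; move: (fun _ => True) => P b.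
suff : forall Q : N -> Prop, (forall x, Q x -> P x) -> bound (M := N) n Q by apply.
move: P b; elim: n => [|n IH] P b Q QP N' hN' s [x qx nx].
  apply: (b N'); [|by move=> y /s/QP|by exists x => //; exact: QP].
  by split=> [|a u v]; [exact: (submod0 hN') | exact: (submodP hN')].
apply: (IH N') => //; apply: (b N'); [|by move=> y /s/QP|by exists x => //; exact: QP].
by split=> [|a u v]; [exact: (submod0 hN') | exact: (submodP hN')].
Qed.
End Restriction.

(** * Duality for artin algebras *)

Section RModuleDuality.
Variable R : comPzRingType.
Hypothesis hR : artinian R.
Variable E : fgModType R.
Hypotheses (mE : multiplicity_free E) (iE : injective_module E).
Hypothesis sE : forall T : fgModType R, simple T ->
  exists f : {linear T -> E}, exists t, f t <> 0.

Let flR : finite_length_ring R := artinian_finite_length hR.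

(** Extend to [Q] a map from a simple quotient of the cyclic module [R x]. *)
Lemma cogenerator (Q : fgModType R) (x : Q) : x <> 0 -> exists f : {linear Q -> E}, f x <> 0.
Proof.
move=> x0.
have [K [i [ii iP]]] := sub_fg flR (submod_range (rmap x)).
have [k ik] : exists k, i k = x by apply/iP; exists 1; exact: scale1r.
have kgen z : exists a : R, z = a *: k.
  have [a ea] : exists a, rmap x a = i z by apply/iP; exists z.
  by exists a; apply: ii; rewrite linearZ ik -ea.
have k0 : k <> 0 by move=> e; apply: x0; rewrite -ik e linear0.
have [n bK] := flR K.
have [|N [hN pN Nmax]] := maximal_submodule bK; first by exists k.
have [T [p [sp kp]]] := quot_fg hN.
have [g [t gt]] := sE (quot_simple sp kp pN Nmax).
have [f fP] := iE (g \o p) ii.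
exists f => fx; apply: gt; have [z <-] := sp t; have [a ->] := kgen z.
by rewrite !linearZ; have /= <- := fP k; rewrite ik fx scaler0.
Qed.

(** Evaluation embeds [Q] into its bidual, which is no longer than [Q]. *)
Lemma bidual_surj (Q : fgModType R) (phi : {linear homR E Q -> E}) :
  exists x : Q, forall f : homR E Q, phi f = f x.
Proof.
have lev x : linear (fun f : homR E Q => f x).
  by move=> a f g; congr (_ + _); exact: (homZ f a x).
pose ev x : homR E (homR E Q) := homR_of (mklin (lev x)).
have lev' : linear ev by move=> a x y; apply: hom_ext => f; rewrite /= homP (homZ f a x).
have evi : injective (mklin lev').
  apply: linear_inj => x ex; apply: contrapT => /cogenerator [f]; apply.
  exact: (congr1 (fun h : homR E (homR E Q) => h (homR_of f)) ex).
have exn : exists n, `[< length_le Q n >].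
  by have [n bn] := flR Q; exists n; apply/asboolP.
case: (ex_minnP exn) => n /asboolP bn nmin.
have bH := length_hom hR mE bn.
have bHH : length_le (homR E (homR E Q)) n.
  exact: (@length_hom _ hR _ mE _ (FgMod (noetherian_fg bH)) bH).
apply: contrapT => nex.
have prop : exists2 h : homR E (homR E Q), True & ~ exists x, mklin lev' x = h.
  exists (homR_of phi) => // -[x ex]; apply: nex; exists x => f.
  exact/esym/(congr1 (fun h : homR E (homR E Q) => h f) ex).
case: n bn nmin bHH {bH} => [|n] bn nmin bHH;
  have b := bHH _ (submod_range (mklin lev')) (fun _ _ => I) prop => //.
have : (n < n)%N by apply: nmin; apply/asboolP; exact: length_range evi b.
by rewrite ltnn.
Qed.

End RModuleDuality.

(** A finite algebra over [R] and an anti-isomorphic one. The symmetric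
    formulation lets a single construction give the duality in both directions;
    with primitive projections, exchanging the two algebras twice is the identity
    by conversion. *)
#[projections(primitive)]
Record opposite_algebras (R A A' : pzRingType) := OppositeAlgebras {
  oa_sc : {rmorphism R -> A};
  oa_sc' : {rmorphism R -> A'};
  oa_tau : A' -> A;
  oa_tau' : A -> A';
  oa_central : central oa_sc;
  oa_central' : central oa_sc';
  oa_anti : antimorphism oa_tau;
  oa_anti' : antimorphism oa_tau';
  oa_tauK : cancel oa_tau' oa_tau;
  oa_tauK' : cancel oa_tau oa_tau';
  oa_tau_sc : forall r, oa_tau (oa_sc' r) = oa_sc r;
  oa_tau_sc' : forall r, oa_tau' (oa_sc r) = oa_sc' r;
  oa_fg : finitely_generated (restr oa_sc A^o);
  oa_fg' : finitely_generated (restr oa_sc' A'^o) }.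

Definition opposite_sym (R A A' : pzRingType) (o : opposite_algebras R A A') :
  opposite_algebras R A' A :=
  OppositeAlgebras (oa_central' o) (oa_central o) (oa_anti' o) (oa_anti o) (oa_tauK' o)
    (oa_tauK o) (oa_tau_sc' o) (oa_tau_sc o) (oa_fg' o) (oa_fg o).

(** The properties of a duality through which statements on injective modules
    are translated into statements on projective modules. *)
Record exact_contra (A A' : pzRingType) := ExactContra {
  contra :> fgModType A -> fgModType A';
  contra_map : forall M N : fgModType A, {linear M -> N} -> {linear contra N -> contra M};
  contra_id : forall (M : fgModType A) (u : {linear M -> M}), u =1 id -> contra_map u =1 id;
  contra_comp : forall (M N Q : fgModType A) (u : {linear M -> N}) (v : {linear N -> Q}),
    contra_map (v \o u : {linear M -> Q}) =1 contra_map u \o contra_map v;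
  contra_inj : forall (M N : fgModType A) (u : {linear M -> N}),
    injective u -> surj (contra_map u);
  contra_surj : forall (M N : fgModType A) (u : {linear M -> N}),
    surj u -> injective (contra_map u);
  contra_exact : forall (M N Q : fgModType A) (u : {linear M -> N}) (v : {linear N -> Q}),
    exact_at u v -> exact_at (contra_map v) (contra_map u);
  contra_proj : forall P, projective P -> injective_module (contra P);
  contra_injective : forall I, injective_module I -> projective (contra I) }.

Record duality (A A' : pzRingType) := Duality {
  dual :> exact_contra A A';
  codual : exact_contra A' A;
  dual_unit : forall M : fgModType A, exists2 f : {linear M -> codual (dual M)}, injective f & surj f;
  codual_unit : forall M : fgModType A', exists2 f : {linear M -> dual (codual M)}, injective f & surj f }.

Definition duality_sym (A A' : pzRingType) (D : duality A A') : duality A' A :=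
  Duality (codual_unit D) (dual_unit D).

Section DualityConstruction.
Variables (R : comPzRingType) (E : fgModType R).
Hypotheses (hR : artinian R) (mE : multiplicity_free E) (iE : injective_module E).
Hypothesis sE : forall T : fgModType R, simple T ->
  exists f : {linear T -> E}, exists t, f t <> 0.

Let flR : finite_length_ring R := artinian_finite_length hR.

Section OneSide.
Variables (A A' : pzRingType) (o : opposite_algebras R A A').
Local Notation homE M := (hom_mod (oa_central o) (oa_anti o) E M).

Definition resR (M : fgModType A) : fgModType R := FgMod (restr_fg M (oa_fg o)).

Definition hom_of_res (M : fgModType A) (f : homR E (resR M)) : homE M :=
  @MkHom R A (oa_sc o) E M f (fun r x y => homP f r x y).
Definition res_of_hom (M : fgModType A) (f : homE M) : homR E (resR M) :=
  @MkHom R R (idfun : {rmorphism R -> R}) E (resR M) f (fun r x y => homP f r x y).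

Fact hom_fg (M : fgModType A) : finitely_generated (homE M).
Proof.
have [n bn] := flR (resR M).
have lin : linear (fun f : homR E (resR M) => (hom_of_res f : restr (oa_sc' o) (homE M))).
  move=> r f g; apply: hom_ext => x; congr (_ + _).
  by congr (f _); rewrite /= (oa_tau_sc o).
have := length_surj (f := mklin lin) _ (length_hom hR mE bn).
move=> h; have /length_restr b : length_le (restr (oa_sc' o) (homE M)) n.
  by apply: h => f; exists (res_of_hom f); apply: hom_ext.
exact: noetherian_fg b.
Qed.

Definition dual_obj (M : fgModType A) : fgModType A' := FgMod (hom_fg M).

Definition dual_map (M N : fgModType A) (u : {linear M -> N}) :
  {linear dual_obj N -> dual_obj M} := hom_map (oa_central o) (oa_anti o) E u.

Lemma dual_inj (M N : fgModType A) (u : {linear M -> N}) : injective u -> surj (dual_map u).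
Proof.
move=> ui f.
have [g gP] := iE (X := resR M) (Y := resR N) (f := restr_map (oa_sc o) u)
  (homR_lin (res_of_hom f)) ui.
by exists (hom_of_res (homR_of g)); apply: hom_ext => x; exact: gP.
Qed.

Lemma dual_surj (M N : fgModType A) (u : {linear M -> N}) : surj u -> injective (dual_map u).
Proof.
move=> su f g e; apply: hom_ext => y; have [x <-] := su y.
exact: (congr1 (fun h : homE M => h x) e).
Qed.

Lemma dual_exact (M N Q : fgModType A) (u : {linear M -> N}) (v : {linear N -> Q}) :
  exact_at u v -> exact_at (dual_map v) (dual_map u).
Proof.
move=> ex h; split=> [uh|[f <-]]; last first.
  by apply: hom_ext => x /=; have /ex -> : exists z, u z = u x; [exists x | exact: (hom0 f)].
have [K [p [sp kp]]] := quot_fg (submod_ker (restr_map (oa_sc o) v : {linear resR N -> resR Q})).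
have [i iP] := linear_factor (f := (restr_map (oa_sc o) v : {linear resR N -> resR Q})) sp
  (fun x => (kp x).1).
have [k kP] : exists k : {linear K -> E}, forall x, k (p x) = homR_lin (res_of_hom h) x.
  apply: (linear_factor sp) => x /kp /ex [z <-].
  exact: (congr1 (fun h : homE M => h z) uh).
have [|g gP] := iE k (f := i).
  by apply: linear_inj => q; have [x <-] := sp q; rewrite iP => ?; apply/kp.
exists (hom_of_res (homR_of g)); apply: hom_ext => x.
by rewrite /= -[LHS]/(g (restr_map (oa_sc o) v x)) -iP gP kP.
Qed.

End OneSide.

Section Evaluation.
Variables (A A' : pzRingType) (o : opposite_algebras R A A').
Local Notation D := (dual_obj o).
Local Notation D' := (dual_obj (opposite_sym o)).

Fact eval_proof (M : fgModType A) (x : M) r (f g : D M) :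
  (oa_sc' o r *: f + g) x = r *: f x + g x.
Proof. by rewrite -(homZ f) -(oa_tau_sc o). Qed.
Definition eval_fun (M : fgModType A) (x : M) : D' (D M) :=
  @MkHom R A' (oa_sc' o) E (D M) (fun f : D M => f x) (eval_proof x).
Fact eval_linear (M : fgModType A) : linear (@eval_fun M).
Proof.
move=> a x y; apply: hom_ext => f; rewrite /= homD; congr (_ + _).
by rewrite /= (oa_tauK o).
Qed.
Definition eval (M : fgModType A) : {linear M -> D' (D M)} := mklin (@eval_linear M).

Lemma eval_inj M : injective (eval M).
Proof.
apply: linear_inj => x ex; apply: contrapT => x0.
have [f] := cogenerator hR iE sE (Q := resR o M) x0; apply.
exact: (congr1 (fun h : D' (D M) => h (hom_of_res (homR_of f))) ex).
Qed.

Lemma eval_surj M : surj (eval M).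
Proof.
move=> phi.
have lin : linear (fun f : homR E (resR o M) => phi (hom_of_res f)).
  move=> r f g; have := homP phi r (hom_of_res f) (hom_of_res g).
  move=> <-; congr (phi _); apply: hom_ext => x; congr (_ + _).
  by congr (f _); rewrite /= (oa_tau_sc o).
have [x xP] := bidual_surj hR mE iE sE (mklin lin).
exists x; apply: hom_ext => f.
have := xP (res_of_hom f) => /= <-; congr (phi _); exact: hom_ext.
Qed.

End Evaluation.

(** By adjunction, extending a map [X -> D P] along a monomorphism [X -> Y]
    amounts to lifting a map [P -> D X] along [D Y -> D X]. *)
Lemma dual_proj (A A' : pzRingType) (o : opposite_algebras R A A') P :
  projective P -> injective_module (dual_obj o P).
Proof.
move=> pP X Y u g ui.
have [h hP] := pP _ _ _ (dual_map (opposite_sym o) g \o eval o P)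
  (@dual_inj _ _ (opposite_sym o) _ _ u ui).
exists (dual_map o h \o eval (opposite_sym o) Y) => x; apply: hom_ext => p.
exact: (congr1 (fun k : dual_obj (opposite_sym o) X => k x) (hP p)).
Qed.

(** By reflexivity, lifting a map [D I -> Y] along [X -> Y] amounts to
    extending a map [D Y -> I] along [D Y -> D X]. *)
Lemma dual_injective (A A' : pzRingType) (o : opposite_algebras R A A') I :
  injective_module I -> projective (dual_obj o I).
Proof.
move=> iI X Y u g su.
have [e [eK1 eK2]] := linear_inverse (@eval_inj _ _ o I) (@eval_surj _ _ o I).
have [h hP] := iI _ _ _ (e \o dual_map (opposite_sym o) g)
  (@dual_surj _ _ (opposite_sym o) _ _ u su).
have [e' [e'K1 _]] := linear_inverse (@eval_inj _ _ (opposite_sym o) X)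
  (@eval_surj _ _ (opposite_sym o) X).
exists (e' \o dual_map o h) => f.
have evY := @eval_inj _ _ (opposite_sym o) Y; apply: evY; apply: hom_ext => psi.
have := congr1 (fun k : dual_obj o (dual_obj (opposite_sym o) X) =>
  k (dual_map (opposite_sym o) u psi)) (e'K1 (dual_map o h f)).
rewrite /= => ->; rewrite hP.
exact: (congr1 (fun k : dual_obj (opposite_sym o) (dual_obj o I) => k f)
  (eK1 (dual_map (opposite_sym o) g psi))).
Qed.

Definition dual_contra (A A' : pzRingType) (o : opposite_algebras R A A') : exact_contra A A'.
Proof.
apply: (@ExactContra A A' (dual_obj o) (dual_map o)).
- by move=> M u uid f; apply: hom_ext => x /=; rewrite uid.
- by move=> M N Q u v f; apply: hom_ext.
- exact: dual_inj.
- exact: dual_surj.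
- exact: dual_exact.
- exact: dual_proj.
- exact: dual_injective.
Defined.

Definition algebra_duality (A A' : pzRingType) (o : opposite_algebras R A A') : duality A A'.
Proof.
apply: (@Duality A A' (dual_contra o) (dual_contra (opposite_sym o))) => M.
- by exists (eval o M); [exact: eval_inj | exact: eval_surj].
- by exists (eval (opposite_sym o) M);
    [exact: (@eval_inj _ _ (opposite_sym o) M) | exact: (@eval_surj _ _ (opposite_sym o) M)].
Defined.

End DualityConstruction.

Lemma finite_length_algebra (R : comPzRingType) (A : pzRingType) (rho : {rmorphism R -> A}) :
  artinian R -> finitely_generated (restr rho A^o) -> finite_length_ring A.
Proof.
move=> hR fgA.
have [m bm] := artinian_finite_length hR (FgMod fgA).
exact: (finite_length_regular (length_restr (N := A^o) bm)).
Qed.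

(** * Projective dimension *)

Section Dimensions.
Variable A : pzRingType.
Implicit Types C I K M N P Q X Y Z : fgModType A.

Definition ses X Y Z (i : {linear X -> Y}) (p : {linear Y -> Z}) :=
  [/\ injective i, surj p & exact_at i p].

Definition retract M X (s : {linear M -> X}) (r : {linear X -> M}) := forall x, r (s x) = x.

Lemma projective_retract M X (s : {linear M -> X}) (r : {linear X -> M}) :
  retract s r -> projective X -> projective M.
Proof.
move=> rs pX Y Z f g sf; have [h hP] := pX _ _ f (g \o r) sf.
by exists (h \o s) => x; rewrite hP /= rs.
Qed.

Lemma injective_retract M X (s : {linear M -> X}) (r : {linear X -> M}) :
  retract s r -> injective_module X -> injective_module M.
Proof.
move=> rs iX Y Z f g fi; have [h hP] := iX _ _ f (s \o g) fi.
by exists (r \o h) => x; rewrite /= hP /= rs.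
Qed.

Lemma zero_projective M : is_zero M -> projective M.
Proof. by move=> M0 X Y f g _; exists \0 => x; rewrite (M0 x) !linear0. Qed.

Lemma zero_injective M : is_zero M -> injective_module M.
Proof. by move=> M0 X Y f g _; exists \0 => x; rewrite (M0 (g x)). Qed.

Lemma dsum_projective P Q : projective P -> projective Q -> projective (P [+] Q).
Proof.
move=> pP pQ X Y f g sf.
have [h hP] := pP _ _ f (g \o dinl P Q) sf; have [k kP] := pQ _ _ f (g \o dinr P Q) sf.
exists (copair h k) => -[x y]; rewrite /= linearD hP kP /= -linearD.
by congr (g (_, _)); rewrite /= ?addr0 ?add0r.
Qed.

Lemma dsum_injective P Q : injective_module P -> injective_module Q ->
  injective_module (P [+] Q).
Proof.
move=> pP pQ X Y f g fi.
have [h hP] := pP _ _ f (dfst P Q \o g) fi; have [k kP] := pQ _ _ f (dsnd P Q \o g) fi.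
by exists (pairing h k) => x; rewrite /= hP kP /= -surjective_pairing.
Qed.

Lemma regular_projective : projective (regular_mod A).
Proof.
move=> X Y f g sf; have [x fx] := sf (g (1 : A)).
exists (rmap x) => a; rewrite /rmap /= /orbit_map linearZ fx -linearZ.
by congr (g _); exact: mulr1.
Qed.

Lemma free_projective n : projective (free_mod A n).
Proof.
elim: n => [|n IH]; first exact: zero_projective (@zero_modP A).
exact: dsum_projective IH regular_projective.
Qed.

Lemma copies_injective I n : injective_module I -> injective_module (copies I n).
Proof.
move=> iI; elim: n => [|n IH]; first exact: zero_injective (@zero_modP A).
exact: dsum_injective.
Qed.

Lemma projective_retract_free P : projective P ->
  exists n (s : {linear P -> free_mod A n}) r, retract s r.
Proof.
move=> pP; have [n [p sp]] := free_cover P.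
by have [s sP] := pP _ _ p idfun sp; exists n, s, p.
Qed.

Lemma coker_ses X Y (i : {linear X -> Y}) : injective i ->
  exists Z (p : {linear Y -> Z}), ses i p.
Proof.
move=> ii; have [Z [p [sp kp]]] := quot_fg (submod_range i).
by exists Z, p; split.
Qed.

(** Dimensions are bounded by iterated syzygies instead of full resolutions,
    which makes inductions on the dimension immediate. *)
Fixpoint pd_le n M : Prop :=
  if n is n'.+1 then exists P K (i : {linear K -> P}) (p : {linear P -> M}),
    [/\ projective P, ses i p & pd_le n' K]
  else projective M.

Fixpoint id_le n M : Prop :=
  if n is n'.+1 then exists I C (i : {linear M -> I}) (p : {linear I -> C}),
    [/\ injective_module I, ses i p & id_le n' C]
  else injective_module M.

Definition fpd M := exists n, pd_le n M.
Definition fid M := exists n, id_le n M.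

Lemma bij_retract M N (f : {linear M -> N}) : injective f -> surj f ->
  exists g : {linear N -> M}, retract f g /\ retract g f.
Proof. by move=> fi sf; have [g [h1 h2]] := linear_inverse fi sf; exists g. Qed.

Lemma ses_iso_right X Y Z Z' (i : {linear X -> Y}) (p : {linear Y -> Z}) (f : {linear Z -> Z'}) :
  injective f -> surj f -> ses i p -> ses i (f \o p).
Proof.
move=> fi sf [ii sp e]; split=> // [z'|y /=].
  by have [z <-] := sf z'; have [y <-] := sp z; exists y.
by rewrite -(e y); split=> [/(linear_inj0 fi) //|->]; rewrite linear0.
Qed.

Lemma ses_iso_left X Y Z X' (i : {linear X -> Y}) (p : {linear Y -> Z}) (f : {linear X' -> X}) :
  injective f -> surj f -> ses i p -> ses (i \o f) p.
Proof.
move=> fi sf [ii sp e]; split=> // [|y /=]; first exact: inj_comp.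
rewrite e; split=> [[x <-]|[x <-]]; last by exists (f x).
by have [x' <-] := sf x; exists x'.
Qed.

Lemma pd_le_iso n M N (f : {linear M -> N}) : injective f -> surj f -> pd_le n M -> pd_le n N.
Proof.
move=> fi sf; case: n => [|n] /=.
  by have [g [_ h]] := bij_retract fi sf; exact: projective_retract h.
move=> [P [K [i [p [pP s hK]]]]]; exists P, K, i, (f \o p); split=> //.
exact: ses_iso_right.
Qed.

Lemma ses_id M : ses (\0 : {linear zero_mod A -> M}) (idfun : {linear M -> M}).
Proof.
split=> [x y _|y|y]; [by rewrite (zero_modP x) (zero_modP y) | by exists y|].
by split=> [/= ->|[x <-]] //; exists 0.
Qed.

Lemma pd_leS n M : pd_le n M -> pd_le n.+1 M.
Proof.
elim: n M => [|n IH] M.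
  move=> pM; exists M, (zero_mod A), \0, idfun; split=> //; first exact: ses_id.
  exact: zero_projective (@zero_modP A).
by move=> [P [K [i [p [pP s /IH hK]]]]]; exists P, K, i, p.
Qed.

Lemma pd_le_leq m n M : (m <= n)%N -> pd_le m M -> pd_le n M.
Proof.
by move=> /subnK <-; elim: (n - m)%N => // k IH h; rewrite addSn; apply/pd_leS/IH.
Qed.

Lemma ses_section X Y Z (i : {linear X -> Y}) (p : {linear Y -> Z}) : ses i p -> projective Z ->
  exists (s : {linear Z -> Y}) (k : {linear Y -> X}), forall y, y = i (k y) + s (p y).
Proof.
move=> [ii sp e] pZ; have [s sP] := pZ _ _ p idfun sp.
have [|k kP] := linear_lift (f := (idfun \- (s \o p) : {linear Y -> Y})) ii.
  by move=> y; apply/e; rewrite /= linearB sP subrr.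
by exists s, k => y; rewrite kP /= subrK.
Qed.

Section FiniteLength.
Hypothesis flA : finite_length_ring A.

Lemma ker_ses Y Z (p : {linear Y -> Z}) : surj p ->
  exists X (i : {linear X -> Y}), ses i p.
Proof.
move=> sp; have [X [i [ii iP]]] := sub_fg flA (submod_ker p).
by exists X, i; split.
Qed.

(** The horseshoe lemma: a cover of [N], lifted to [M], together with a cover of
    [K] covers [M], and the three syzygies again form a short exact sequence. *)
Lemma pd_le_ext n K M N (i : {linear K -> M}) (p : {linear M -> N}) :
  ses i p -> pd_le n K -> pd_le n N -> pd_le n M.
Proof.
elim: n K M N i p => [|n IH] K M N i p s.
  move=> pK pN X Y f g sf; have [t [k kP]] := ses_section s pN.
  have [h1 h1P] := pK _ _ f (g \o i) sf; have [h2 h2P] := pN _ _ f (g \o t) sf.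
  exists ((h1 \o k) \+ (h2 \o p)) => x; rewrite /= linearD h1P h2P /= -linearD.
  by rewrite -kP.
move=> [P1 [K1 [i1 [p1 [pP1 [i1i sp1 e1] hK1]]]]] [P2 [K2 [i2 [p2 [pP2 [i2i sp2 e2] hK2]]]]].
have [ii sp e] := s.
have [q qP] := pP2 _ _ p p2 sp.
have sq : surj (copair (i \o p1) q).
  move=> m; have [y ey] := sp2 (p m).
  have /e [k ik] : p (m - q y) = 0 by rewrite linearB qP ey subrr.
  have [x px] := sp1 k.
  by exists (x, y); rewrite /= px ik subrK.
have [W [j sW]] := ker_ses sq; have [ji _ eW] := sW.
have [u uP] : exists u : {linear K1 -> W}, forall x, j (u x) = (i1 x, 0).
  apply: (linear_lift (f := dinl P1 P2 \o i1) ji) => x; apply/eW => /=.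
  have -> : p1 (i1 x) = 0 by apply/e1; exists x.
  by rewrite !linear0 addr0.
have [v vP] : exists v : {linear W -> K2}, forall x, i2 (v x) = (j x).2.
  apply: (linear_lift (f := dsnd P1 P2 \o j) i2i) => w; apply/e2.
  have : copair (i \o p1) q (j w) = 0 by apply/eW; exists w.
  move=> /(congr1 p); rewrite /= linearD linear0 qP => <-.
  have -> : p (i (p1 (j w).1)) = 0 by apply/e; exists (p1 (j w).1).
  by rewrite add0r.
exists (P1 [+] P2), W, j, (copair (i \o p1) q); split=> //; first exact: dsum_projective.
apply: (IH K1 W K2 u v) => //; split.
- by apply: linear_inj => x ux; apply: (linear_inj0 i1i); have := uP x; rewrite ux linear0 => -[].
- move=> k2; have /e [k ik] : p (q (i2 k2)) = 0 by rewrite qP; apply/e2; exists k2.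
  have [x px] := sp1 k.
  have /eW [w jw] : copair (i \o p1) q (- x, i2 k2) = 0.
    by rewrite /= !linearN px ik addNr.
  by exists w; apply: i2i; rewrite vP jw.
- move=> w; split=> [vw|[x <-]]; last by apply: (linear_inj0 i2i); rewrite vP uP.
  have jw2 : (j w).2 = 0 by rewrite -vP vw linear0.
  have : copair (i \o p1) q (j w) = 0 by apply/eW; exists w.
  rewrite /= jw2 linear0 addr0 => /(linear_inj0 ii) /e1 [x ex].
  by exists x; apply: ji; rewrite uP ex -jw2 -surjective_pairing.
Qed.

(** A projective module mapping onto [M] also maps onto [N], and the syzygy of
    [N] so obtained is an extension of [K] by the syzygy of [M]. *)
Lemma pd_le_coker n K M N (i : {linear K -> M}) (p : {linear M -> N}) :
  ses i p -> pd_le n K -> pd_le n M -> pd_le n.+1 N.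
Proof.
move=> [ii sp e] hK /pd_leS [P [M' [i' [p' [pP [i'i sp' e'] hM']]]]].
have [|N' [j sj]] := @ker_ses P N (p \o p').
  by move=> z; have [y <-] := sp z; have [x <-] := sp' y; exists x.
exists P, N', j, (p \o p'); split=> //; have [ji _ ej] := sj.
have [u uP] : exists u : {linear M' -> N'}, forall x, j (u x) = i' x.
  apply: (linear_lift (f := i') ji) => x; apply/ej => /=.
  by have -> : p' (i' x) = 0; [apply/e'; exists x | rewrite linear0].
have [v vP] : exists v : {linear N' -> K}, forall x, i (v x) = p' (j x).
  apply: (linear_lift (f := p' \o j) ii) => x; apply/e.
  by apply/ej; exists x.
apply: (pd_le_ext (i := u) (p := v)) hM' hK; split.
- by apply: linear_inj => x ux; apply: (linear_inj0 i'i); rewrite -uP ux linear0.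
- move=> k; have [y ey] := sp' (i k).
  have /ej [x jx] : (p \o p') y = 0 by rewrite /= ey; apply/e; exists k.
  by exists x; apply: ii; rewrite vP jx.
- move=> x; split=> [vx|[y <-]].
    have /e' [y i'y] : p' (j x) = 0 by rewrite -vP vx linear0.
    by exists y; apply: ji; rewrite uP.
  by apply: (linear_inj0 ii); rewrite vP uP; apply/e'; exists y.
Qed.

Lemma ses_dinl K P : ses (dinl K P) (dsnd K P).
Proof.
split=> [x y []//|y|[x y]]; first by exists (0, y).
by split=> [/= ->|[z [_ <-]]] //; exists x.
Qed.

Lemma ses_dinr K P : ses (dinr K P) (dfst K P).
Proof.
split=> [x y []//|x|[x y]]; first by exists (x, 0).
by split=> [/= ->|[z [<- _]]] //; exists y.
Qed.

Lemma projective_pd_le n P : projective P -> pd_le n P.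
Proof. by move=> pP; exact: (@pd_le_leq 0). Qed.

Lemma pd_le_dsum n K P : pd_le n K -> pd_le n P -> pd_le n (K [+] P).
Proof. exact: pd_le_ext (ses_dinl K P). Qed.

(** Lift to [M] a map of a projective module [P] onto [N]. Then [K + P] covers
    [M] with kernel the syzygy of [N], so it has finite projective dimension, and
    [K] is the cokernel of [P -> K + P]. *)
Lemma pd_le_ker n K M N (i : {linear K -> M}) (p : {linear M -> N}) :
  ses i p -> pd_le n M -> pd_le n N -> pd_le n.+1 K.
Proof.
move=> [ii sp e] hM /pd_leS [P [N' [j [q [pP [ji sq ej] hN']]]]].
have [t tP] := pP _ _ p q sp.
have [u uP] : exists u : {linear N' -> K}, forall x, i (u x) = - t (j x).
  apply: (linear_lift (f := \- (t \o j)) ii) => x; apply/e => /=.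
  by rewrite linearN tP; apply/eqP; rewrite oppr_eq0; apply/eqP/ej; exists x.
have s : ses (pairing u j) (copair i t).
  split.
  - by move=> x y [_ /ji].
  - move=> m; have [y qy] := sq (p m).
    have /e [k ik] : p (m - t y) = 0 by rewrite linearB tP qy subrr.
    by exists (k, y); rewrite /= ik subrK.
  - move=> [k y]; split=> /= [h|[x [<- <-]]]; last by rewrite uP addNr.
    have /ej [x jx] : q y = 0.
      rewrite -tP; have := congr1 p h; rewrite linearD linear0.
      by have -> : p (i k) = 0; [apply/e; exists k | rewrite add0r].
    exists x; congr pair => //; apply: ii; rewrite uP jx.
    by apply/eqP; rewrite eq_sym -addr_eq0; apply/eqP.
have hKP := pd_le_ext s hN' hM.
exact: pd_le_coker (ses_dinr K P) (projective_pd_le _ pP) hKP.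
Qed.

(** Schanuel's lemma: lifting each of the two covers along the other exhibits a
    syzygy as a retract of any other one plus a projective module. *)
Lemma schanuel M K P K' P' (i : {linear K -> P}) (p : {linear P -> M})
    (i' : {linear K' -> P'}) (p' : {linear P' -> M}) :
  projective P -> projective P' -> ses i p -> ses i' p' ->
  exists (s : {linear K' -> K [+] P'}) r, retract s r.
Proof.
move=> pP pP' [ii sp e] [i'i sp' e'].
have [a aP] := pP' _ _ p p' sp; have [b bP] := pP _ _ p' p sp'.
have [c cP] : exists c : {linear K' -> K}, forall x, i (c x) = a (i' x).
  apply: (linear_lift (f := a \o i') ii) => x; apply/e.
  by rewrite /= aP; apply/e'; exists x.
have [r rP] : exists r : {linear K [+] P' -> K'},
    forall z, i' (r z) = z.2 - b (a z.2) + b (i z.1).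
  have [|r rP] := linear_lift
    (f := copair (b \o i) (idfun \- (b \o a)) : {linear K [+] P' -> P'}) i'i.
    move=> [k x]; apply/e'; rewrite /= linearD bP linearB bP aP subrr addr0.
    by apply/e; exists k.
  by exists r => z; rewrite rP /= addrC.
by exists (pairing c i'), r => x; apply: i'i; rewrite rP /= cP subrK.
Qed.

(** The syzygy of [M] is a retract of a syzygy of [X], which by Schanuel's lemma
    is a retract of the given syzygy of [X] plus a projective module. *)
Lemma pd_le_retract n M X (s : {linear M -> X}) (r : {linear X -> M}) :
  retract s r -> pd_le n X -> pd_le n M.
Proof.
elim: n M X s r => [|n IH] M X s r rs; first exact: projective_retract rs.
move=> [P [K [i [p [pP sK hK]]]]]; have [ii sp e] := sK.
have spM : surj (r \o p).
  by move=> m; have [y py] := sp (s m); exists y; rewrite /= py rs.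
have [M' [j sj]] := ker_ses spM; have [ji _ ej] := sj.
exists P, M', j, (r \o p); split=> //.
(* P + P covers X = M + Ker r with one copy of P for each summand. *)
pose q : {linear P [+] P -> X} := copair (s \o r \o p) (p \- (s \o r \o p)).
have sq : surj q.
  by move=> x; have [y <-] := sp x; exists (y, y); rewrite /= addrC subrK.
have [K' [j' sj']] := ker_ses sq; have [j'i _ ej'] := sj'.
have pPP := dsum_projective pP pP.
have [a [b ab]] := schanuel pP pPP sK sj'.
have [c cP] : exists c : {linear M' -> K'}, forall x, j' (c x) = (j x, 0).
  apply: (linear_lift (f := dinl P P \o j) j'i) => x; apply/ej'.
  rewrite /q /= !linear0 !addr0.
  have -> : r (p (j x)) = 0 by apply/ej; exists x.
  by rewrite linear0.
have [d dP] : exists d : {linear K' -> M'}, forall x, j (d x) = (j' x).1.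
  apply: (linear_lift (f := dfst P P \o j') ji) => x; apply/ej => /=.
  have /(congr1 r) : q (j' x) = 0 by apply/ej'; exists x.
  by rewrite /q /= linearD linearB !rs subrr addr0 linear0.
apply: (IH M' (K [+] (P [+] P)) (a \o c) (d \o b)).
  by move=> x; rewrite /= ab; apply: ji; rewrite dP cP.
by apply: pd_le_dsum => //; exact: projective_pd_le.
Qed.

Lemma pd_le_syzygy n M K P (i : {linear K -> P}) (p : {linear P -> M}) :
  projective P -> ses i p -> pd_le n M -> pd_le n.-1 K.
Proof.
move=> pP s hM.
have [P' [K' [i' [p' [pP' s' hK']]]]] : pd_le n.-1.+1 M.
  by case: n hM => [/pd_leS|n].
have [a [b ab]] := schanuel pP' pP s' s.
apply: (pd_le_retract ab); apply: pd_le_dsum => //; exact: projective_pd_le.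
Qed.

Lemma fpd_retract M X (s : {linear M -> X}) (r : {linear X -> M}) :
  retract s r -> fpd X -> fpd M.
Proof. by move=> rs [n h]; exists n; exact: pd_le_retract rs h. Qed.

Lemma fpd_common M N : fpd M -> fpd N -> exists n, pd_le n M /\ pd_le n N.
Proof.
move=> [m hM] [n hN]; exists (m + n)%N; split.
  by apply: pd_le_leq hM; rewrite leq_addr.
by apply: pd_le_leq hN; rewrite leq_addl.
Qed.

Section FpdSes.
Variables (K M N : fgModType A) (i : {linear K -> M}) (p : {linear M -> N}).
Hypothesis s : ses i p.

Lemma fpd_ext : fpd K -> fpd N -> fpd M.
Proof. by move=> hK /(fpd_common hK) [n [h1 h2]]; exists n; exact: pd_le_ext s h1 h2. Qed.
Lemma fpd_coker : fpd K -> fpd M -> fpd N.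
Proof. by move=> hK /(fpd_common hK) [n [h1 h2]]; exists n.+1; exact: pd_le_coker s h1 h2. Qed.
Lemma fpd_ker : fpd M -> fpd N -> fpd K.
Proof. by move=> hK /(fpd_common hK) [n [h1 h2]]; exists n.+1; exact: pd_le_ker s h1 h2. Qed.
End FpdSes.

Lemma fpd_iso M N (f : {linear M -> N}) : injective f -> surj f -> fpd M -> fpd N.
Proof. by move=> fi sf [n h]; exists n; exact: pd_le_iso fi sf h. Qed.

Lemma fpd_copies M n : fpd M -> fpd (copies M n).
Proof.
move=> hM; elim: n => [|n IH].
  by exists 0%N; exact: zero_projective (@zero_modP A).
exact: fpd_ext (ses_dinl _ _) IH hM.
Qed.

End FiniteLength.

End Dimensions.

(** * Comparison with resolutions *)

Section Resolutions.
Variable A : pzRingType.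
Implicit Types C I K M N P Q X Y Z : fgModType A.

Section Splice.
Variables (P K M : fgModType A) (i : {linear K -> P}) (p : {linear P -> M}).
Hypotheses (pP : projective P) (s : ses i p) (r : proj_resolution K).

Let obj k := if k is k'.+1 then pres_obj r k' else P.
Let d k : {linear obj k.+1 -> obj k} :=
  if k is k'.+1 then pres_d r k' else i \o pres_aug r.

Fact splice_proj_proj k : projective (obj k).
Proof. by case: k => [|k] //=; exact: pres_proj. Qed.
Fact splice_proj_surj : surj p.
Proof. by case: s. Qed.
Fact splice_proj_exact0 : exact_at (d 0) p.
Proof.
have [_ _ e] := s; move=> y; rewrite e; split=> [[x <-]|[x <-]].
  by have [z <-] := @pres_surj _ _ r x; exists z.
by exists (pres_aug r x).
Qed.
Fact splice_proj_exact k : exact_at (d k.+1) (d k).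
Proof.
have [ii _ _] := s; case: k => [|k] y; last exact: pres_exact.
rewrite /= -(@pres_exact0 _ _ r y); split=> [/(linear_inj0 ii) //|->].
by rewrite linear0.
Qed.
Definition splice_proj : proj_resolution M :=
  ProjResolution splice_proj_proj splice_proj_surj splice_proj_exact0 splice_proj_exact.
End Splice.

Section Cosplice.
Variables (I C M : fgModType A) (i : {linear M -> I}) (p : {linear I -> C}).
Hypotheses (iI : injective_module I) (s : ses i p) (r : inj_resolution C).

Let obj k := if k is k'.+1 then ires_obj r k' else I.
Let d k : {linear obj k -> obj k.+1} :=
  if k is k'.+1 then ires_d r k' else ires_aug r \o p.

Fact splice_inj_inj k : injective_module (obj k).
Proof. by case: k => [|k] //=; exact: ires_inj. Qed.
Fact splice_inj_mono : injective i.
Proof. by case: s. Qed.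
Fact splice_inj_exact0 : exact_at i (d 0).
Proof.
have [_ _ e] := s; move=> y; rewrite -e /=.
by split=> [/(linear_inj0 (@ires_mono _ _ r)) //|->]; rewrite linear0.
Qed.
Fact splice_inj_exact k : exact_at (d k) (d k.+1).
Proof.
have [_ sp _] := s; case: k => [|k] y; last exact: ires_exact.
rewrite /= (@ires_exact0 _ _ r y); split=> [[x <-]|[x <-]]; last by exists (p x).
by have [z <-] := sp x; exists z.
Qed.
Definition splice_inj : inj_resolution M :=
  InjResolution splice_inj_inj splice_inj_mono splice_inj_exact0 splice_inj_exact.
End Cosplice.

Section Trivial.
Variable M : fgModType A.
Let obj k := if k is k'.+1 then zero_mod A else M.

Fact trivial_exact0 : exact_at (\0 : {linear zero_mod A -> M}) (idfun : {linear M -> M}).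
Proof. by have [] := ses_id M. Qed.
Fact trivial_coexact0 : exact_at (idfun : {linear M -> M}) (\0 : {linear M -> zero_mod A}).
Proof. by move=> y; split=> // _; exists y. Qed.
Fact trivial_exact k : exact_at (\0 : {linear obj k.+2 -> obj k.+1})
  (\0 : {linear obj k.+1 -> obj k}).
Proof. by move=> y; split=> // _; exists 0; rewrite [y]zero_modP. Qed.
Fact trivial_coexact k : exact_at (\0 : {linear obj k -> obj k.+1})
  (\0 : {linear obj k.+1 -> obj k.+2}).
Proof. by move=> y; split=> // _; exists 0; rewrite [y]zero_modP. Qed.
Fact trivial_surj : surj (idfun : {linear M -> M}). Proof. by move=> y; exists y. Qed.
Fact trivial_mono : injective (idfun : {linear M -> M}). Proof. by []. Qed.

Lemma projective_resolution : projective M -> proj_dim_le M 0.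
Proof.
move=> pM; have pobj k : projective (obj k).
  by case: k => //= k; exact: zero_projective (@zero_modP A).
by exists (ProjResolution pobj trivial_surj trivial_exact0 trivial_exact) => -[|k] // _;
  exact: zero_modP.
Qed.

Lemma injective_resolution : injective_module M -> inj_dim_le M 0.
Proof.
move=> iM; have iobj k : injective_module (obj k).
  by case: k => //= k; exact: zero_injective (@zero_modP A).
by exists (InjResolution iobj trivial_mono trivial_coexact0 trivial_coexact) => -[|k] // _;
  exact: zero_modP.
Qed.
End Trivial.

Lemma pd_le_resolution n M : pd_le n M -> proj_dim_le M n.
Proof.
elim: n M => [|n IH] M; first exact: projective_resolution.
move=> [P [K [i [p [pP s /IH [r rP]]]]]].
by exists (splice_proj pP s r) => -[|k] //; rewrite ltnS => /rP.
Qed.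

Lemma id_le_resolution n M : id_le n M -> inj_dim_le M n.
Proof.
elim: n M => [|n IH] M; first exact: injective_resolution.
move=> [I [C [i [p [iI s /IH [r rP]]]]]].
by exists (splice_inj iI s r) => -[|k] //; rewrite ltnS => /rP.
Qed.

Lemma resolution_pd_le n M : finite_length_ring A -> proj_dim_le M n -> pd_le n M.
Proof.
move=> flA; elim: n M => [|n IH] M [r r0].
  have inj_aug : injective (pres_aug r).
    apply: linear_inj => x /(@pres_exact0 _ _ r) [y <-].
    by rewrite (r0 1%N isT y) linear0.
  have [g [_ h]] := bij_retract inj_aug (@pres_surj _ _ r).
  exact: projective_retract h (@pres_proj _ _ r 0).
have [K [i s]] := ker_ses flA (@pres_surj _ _ r); have [ii _ e] := s.
exists (pres_obj r 0), K, i, (pres_aug r); split=> //; first exact: pres_proj.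
have [a aP] : exists a : {linear pres_obj r 1 -> K}, forall x, i (a x) = pres_d r 0 x.
  apply: (linear_lift ii) => x; apply/e/(@pres_exact0 _ _ r); by exists x.
have e0 : exact_at (pres_d r 1) a.
  move=> y; rewrite -(@pres_exact _ _ r 0 y) -aP.
  by split=> [->|/(linear_inj0 ii)] //; rewrite linear0.
have sa : surj a.
  move=> k; have /(@pres_exact0 _ _ r) [x ex] : pres_aug r (i k) = 0 by apply/e; exists k.
  by exists x; apply: ii; rewrite aP.
apply: IH; exists (ProjResolution (fun k => @pres_proj _ _ r k.+1) sa e0
  (fun k => @pres_exact _ _ r k.+1)) => k lek.
exact: r0.
Qed.

Lemma resolution_id_le n M : inj_dim_le M n -> id_le n M.
Proof.
elim: n M => [|n IH] M [r r0].
  have surj_aug : surj (ires_aug r).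
    by move=> x; apply/(@ires_exact0 _ _ r); rewrite (r0 1%N isT (ires_d r 0 x)).
  have [g [h _]] := bij_retract (@ires_mono _ _ r) surj_aug.
  exact: injective_retract h (@ires_inj _ _ r 0).
have [C [p s]] := coker_ses (@ires_mono _ _ r); have [ii sp e] := s.
exists (ires_obj r 0), C, (ires_aug r), p; split=> //; first exact: ires_inj.
have [a aP] : exists a : {linear C -> ires_obj r 1}, forall x, a (p x) = ires_d r 0 x.
  by apply: (linear_factor sp) => x /e /(@ires_exact0 _ _ r).
have e0 : exact_at a (ires_d r 1).
  move=> y; rewrite (@ires_exact _ _ r 0 y); split=> [[x <-]|[x <-]].
    by exists (p x).
  by have [z <-] := sp x; exists z.
have ai : injective a.
  apply: linear_inj => c; have [x <-] := sp c.
  by rewrite aP => /(@ires_exact0 _ _ r) /e.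
apply: IH; exists (InjResolution (fun k => @ires_inj _ _ r k.+1) ai e0
  (fun k => @ires_exact _ _ r k.+1)) => k lek.
exact: r0.
Qed.

Lemma proj_dim_finiteP M : finite_length_ring A -> proj_dim_finite M <-> fpd M.
Proof.
move=> flA; split=> -[n h]; exists n; [exact: resolution_pd_le | exact: pd_le_resolution].
Qed.

Lemma inj_dim_finiteP M : inj_dim_finite M <-> fid M.
Proof. by split=> -[n h]; exists n; [exact: resolution_id_le | exact: id_le_resolution]. Qed.

End Resolutions.

(** * Injective dimension, by duality *)

Section InjectiveDimension.
Variables (A A' : pzRingType) (D : duality A A').
Implicit Types M N K X Y Z C I : fgModType A.

Lemma contra_ses (B B' : pzRingType) (F : exact_contra B B') (X Y Z : fgModType B)
    (i : {linear X -> Y}) (p : {linear Y -> Z}) :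
  ses i p -> ses (contra_map F p) (contra_map F i).
Proof.
move=> [ii sp e]; split; [exact: contra_surj | exact: contra_inj | exact: contra_exact].
Qed.

Lemma contra_retract (B B' : pzRingType) (F : exact_contra B B') (X Y : fgModType B)
    (s : {linear X -> Y}) (r : {linear Y -> X}) :
  retract s r -> retract (contra_map F r) (contra_map F s).
Proof.
move=> rs f.
rewrite -[LHS](contra_comp s r f).
by apply: contra_id => x; exact: rs.
Qed.

(** Through this equivalence every closure property of projective dimension
    gives one of injective dimension. *)
Lemma id_le_dual n M : id_le n M <-> pd_le n (D M).
Proof.
split.
  elim: n M => [|n IH] M; first exact: contra_injective.
  move=> [I [C [i [p [iI s hC]]]]].
  exists (D I), (D C), (contra_map D p), (contra_map D i); split.
  - exact: contra_injective.
  - exact: contra_ses.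
  - exact: IH.
elim: n M => [|n IH] M.
  move=> pDM; have [f fi sf] := dual_unit D M.
  have [g [h _]] := bij_retract fi sf.
  exact: injective_retract h (@contra_proj _ _ (codual D) _ pDM).
move=> [P [K [i [p [pP s hK]]]]]; have [f fi sf] := dual_unit D M.
exists (codual D P), (codual D K), (contra_map (codual D) p \o f), (contra_map (codual D) i).
split; first exact: contra_proj.
  exact: ses_iso_left fi sf (contra_ses (codual D) s).
apply: IH; have [g gi sg] := codual_unit D K; exact: pd_le_iso gi sg hK.
Qed.

Lemma fid_dual M : fid M <-> fpd (D M).
Proof. by split=> -[n h]; exists n; apply/id_le_dual. Qed.

Section Closure.
Hypothesis flA' : finite_length_ring A'.

Section FidSes.
Variables (K M N : fgModType A) (i : {linear K -> M}) (p : {linear M -> N}).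
Hypothesis s : ses i p.
Lemma fid_ext : fid K -> fid N -> fid M.
Proof.
by move=> /fid_dual hK /fid_dual hN; apply/fid_dual; exact: fpd_ext (contra_ses D s) hN hK.
Qed.
Lemma fid_coker : fid K -> fid M -> fid N.
Proof.
by move=> /fid_dual hK /fid_dual hN; apply/fid_dual; exact: fpd_ker (contra_ses D s) hN hK.
Qed.
Lemma fid_ker : fid M -> fid N -> fid K.
Proof.
by move=> /fid_dual hK /fid_dual hN; apply/fid_dual; exact: fpd_coker (contra_ses D s) hN hK.
Qed.
End FidSes.

Lemma fid_retract M X (s : {linear M -> X}) (r : {linear X -> M}) :
  retract s r -> fid X -> fid M.
Proof.
move=> rs /fid_dual h; apply/fid_dual.
exact: (fpd_retract flA' (contra_retract (F := D) rs) h).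
Qed.

Lemma fid_iso M N (f : {linear M -> N}) : injective f -> surj f -> fid M -> fid N.
Proof. by move=> fi sf; have [g [_ h]] := bij_retract fi sf; exact: fid_retract h. Qed.

Lemma id_le_cosyzygy n M I C (i : {linear M -> I}) (p : {linear I -> C}) :
  injective_module I -> ses i p -> id_le n M -> id_le n.-1 C.
Proof.
move=> iI s /id_le_dual h; apply/id_le_dual.
exact: pd_le_syzygy (contra_injective iI) (contra_ses D s) h.
Qed.

Lemma fid_free n : fid (regular_mod A) -> fid (free_mod A n).
Proof.
move=> hA; elim: n => [|n IH].
  by exists 0%N; exact: zero_injective (@zero_modP A).
exact: fid_ext (ses_dinl _ _) IH hA.
Qed.

(** Projective modules are retracts of free ones, so they have finite injective
    dimension; the general case follows by induction on the projective
    dimension. *)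
Lemma fpd_fid M : fid (regular_mod A) -> fpd M -> fid M.
Proof.
move=> hA [n]; elim: n M => [|n IH] M.
  move=> /projective_retract_free [n [s [r rs]]].
  exact: fid_retract rs (fid_free n hA).
move=> [P [K [i [p [pP s /IH hK]]]]]; apply: fid_coker s hK _.
have [m [s' [r rs]]] := projective_retract_free pP.
exact: fid_retract rs (fid_free m hA).
Qed.

End Closure.

(** Dualize a free cover of [D M]. *)
Lemma embeds_in_codual_free M : exists n (u : {linear M -> codual D (free_mod A' n)}), injective u.
Proof.
have [n [p sp]] := free_cover (D M); have [f fi _] := dual_unit D M.
exists n, (contra_map (codual D) p \o f); apply: inj_comp => //; exact: contra_surj.
Qed.

Lemma enough_injectives M : exists I (u : {linear M -> I}), injective_module I /\ injective u.
Proof.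
have [n [u ui]] := embeds_in_codual_free M.
exists (codual D (free_mod A' n)), u; split=> //.
exact/contra_proj/free_projective.
Qed.

End InjectiveDimension.

(** The injective dimension of [A'] over itself is the projective dimension of
    its dual, an injective cogenerator of [A]-modules: every injective module is a
    retract of a finite power of it. *)
Lemma fid_opposite (A A' : pzRingType) (D : duality A A') :
  finite_length_ring A ->
  fid (regular_mod A') <-> forall I : fgModType A, injective_module I -> fpd I.
Proof.
move=> flA; split=> [h I iI|h].
  have [n [u ui]] := embeds_in_codual_free D I.
  have [r rP] := iI _ _ _ idfun ui.
  apply: (fpd_retract flA (s := u) (r := r)) => //.
  by apply/(fid_dual (duality_sym D)); exact: fid_free (duality_sym D) flA _ h.
by apply/(fid_dual (duality_sym D)); apply: h; exact/contra_proj/regular_projective.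
Qed.

(** * The perpendicular category of a simple module *)

Section Perpendicular.
Variable A : pzRingType.
Hypothesis flA : finite_length_ring A.
Implicit Types C I K M N P Q W X Y Z : fgModType A.

Section Presentation.
Variables (S P0 P1 : fgModType A) (d : {linear P1 -> P0}) (e : {linear P0 -> S}).
Hypotheses (pP0 : projective P0) (pP1 : projective P1) (sS : ses d e).

(** The vanishing of [Ext^1(S, Z)], computed from the projective presentation
    instead of extensions. *)
Definition extends_from_syzygy Z :=
  forall g : {linear P1 -> Z}, exists h : {linear P0 -> Z}, forall x, h (d x) = g x.

Let se : surj e. Proof. by case: sS. Qed.
Let ede x : e (d x) = 0. Proof. by case: sS => _ _ ex; apply/ex; exists x. Qed.
Let e0 y : e y = 0 -> exists x, d x = y. Proof. by case: sS => _ _ ex /ex. Qed.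
Let di : injective d. Proof. by case: sS. Qed.

(** The pushout of the presentation along [g] is an extension; a splitting of it
    extends [g]. *)
Lemma Ext1_extends Z : Ext1_zero S Z -> extends_from_syzygy Z.
Proof.
move=> ext g; have [W [u [v [uv kuv suv]]]] := pushout d g.
have [out outP] : exists out : {linear W -> S}, forall z : Z [+] P0,
    out (copair u v z) = (e \o dsnd Z P0) z.
  apply: linear_factor => [w|[m y] /=]; first by have [m [y ->]] := suv w; exists (m, y).
  by move=> /kuv [x [_ ->]]; rewrite linearN ede oppr0.
have ou z : out (u z) = 0 by have := outP (z, 0); rewrite /= !linear0 addr0.
have ov y : out (v y) = e y by have := outP (0, y); rewrite /= !linear0 add0r.
have ui : injective u.
  apply: linear_inj => m um; have [|x [-> /esym/eqP]] := kuv m 0.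
    by rewrite um linear0 addr0.
  by rewrite oppr_eq0 => /eqP /(linear_inj0 di) ->; rewrite linear0.
have so : surj out by move=> s; have [y <-] := se s; exists (v y).
have exo : exact_at u out.
  move=> w; split=> [|[z <-] //]; have [m [y ->]] := suv w.
  rewrite linearD ou ov add0r => /e0 [x <-].
  by exists (m + g x); rewrite linearD uv.
have [h [h1 _]] := ext (Extension ui so exo).
exists (dfst Z S \o (h : {linear W -> Z [+] S}) \o v) => x.
by rewrite /= -uv; have := h1 (g x) => /= ->.
Qed.

(** Lift the presentation to the extension, and correct the lift on [P0] so that
    it vanishes on the syzygy: it then defines a section. *)
Lemma extends_Ext1 Z : extends_from_syzygy Z -> Ext1_zero S Z.
Proof.
move=> ext E.
have [t tP] := pP0 e (@ext_epi _ _ _ E).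
have [a aP] : exists a : {linear P1 -> Z}, forall x, ext_in E (a x) = (t \o d) x.
  by apply: (linear_lift (@ext_mono _ _ _ E)) => x; apply/(@ext_exact _ _ _ E); rewrite /= tP.
have [b bP] := ext a.
have [s sP] : exists s : {linear S -> ext_obj E}, forall y, s (e y) = t y - ext_in E (b y).
  apply: (linear_factor (f := (t \- (ext_in E \o b) : {linear P0 -> ext_obj E})) se) => y /e0 [x <-].
  by rewrite /= bP aP subrr.
have outin z : ext_out E (ext_in E z) = 0 by apply/(@ext_exact _ _ _ E); exists z.
have outs x : ext_out E (s x) = x.
  by have [y <-] := se x; rewrite sP linearB outin subr0 tP.
have [k kP] : exists k : {linear ext_obj E -> Z}, forall x,
    ext_in E (k x) = (idfun \- (s \o ext_out E) : {linear ext_obj E -> ext_obj E}) x.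
  apply: (linear_lift (@ext_mono _ _ _ E)) => x; apply/(@ext_exact _ _ _ E).
  by rewrite /= linearB outs subrr.
exists (pairing k (ext_out E) : {linear ext_obj E -> Z [+] S}); split=> //= x.
rewrite outin; congr pair; apply: (@ext_mono _ _ _ E).
by rewrite kP /= outin linear0 subr0.
Qed.

Lemma injective_extends I : injective_module I -> extends_from_syzygy I.
Proof. by move=> iI g; have [h hP] := iI _ _ _ g di; exists h. Qed.

(** The functor Ext^1(S, -) is right exact because the syzygy of [S] is
    projective. *)
Lemma extends_quotient Y Z (q : {linear Y -> Z}) :
  surj q -> extends_from_syzygy Y -> extends_from_syzygy Z.
Proof.
move=> sq eY g; have [g' g'P] := pP1 g sq; have [h hP] := eY g'.
by exists (q \o h) => x; rewrite /= hP g'P.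
Qed.

Definition in_perp Z := Hom_zero S Z /\ extends_from_syzygy Z.

Lemma in_perpP Z : in_perp Z <-> Hom_zero S Z /\ Ext1_zero S Z.
Proof.
by split=> -[h x]; split=> //; [exact: extends_Ext1 | exact: Ext1_extends].
Qed.

Lemma Hom_zero_sub K Y (i : {linear K -> Y}) : injective i -> Hom_zero S Y -> Hom_zero S K.
Proof. by move=> ii hY f s; apply: (linear_inj0 ii); exact: (hY (i \o f)). Qed.

(** For the vanishing of [Hom(S, Z)]: a map [S -> Z] lifts to [S -> Y], as the
    obstruction lies in [Ext^1(S, -)] of the image of [f], a quotient of [X]. *)
Lemma perp_coker X Y Z (f : {linear X -> Y}) (q : {linear Y -> Z}) :
  surj q -> exact_at f q -> in_perp X -> in_perp Y -> in_perp Z.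
Proof.
move=> sq ex [hX eX] [hY eY]; split; last exact: (extends_quotient sq eY).
move=> u s.
have [v vP] := pP0 (u \o e) sq.
have [W [w [wi wP]]] := sub_fg flA (submod_range f).
have [f' f'P] : exists f' : {linear X -> W}, forall x, w (f' x) = f x.
  by apply: (linear_lift wi) => x; apply/wP; exists x.
have sf' : surj f'.
  move=> z; have /wP [x ex'] : exists k, w k = w z by exists z.
  by exists x; apply: wi; rewrite f'P.
have [c cP] : exists c : {linear P1 -> W}, forall x, w (c x) = (v \o d) x.
  by apply: (linear_lift wi) => x; apply/wP/ex; rewrite /= vP /= ede linear0.
have [c' c'P] := pP1 c sf'; have [b bP] := eX c'.
have [t tP] : exists t : {linear S -> Y}, forall y, t (e y) = (v \- (f \o b)) y.
  apply: (linear_factor se) => y /e0 [x <-].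
  by rewrite /= bP -f'P c'P cP /= subrr.
have [y <-] := se s; have /eqP := hY t (e y); rewrite tP subr_eq0 => /eqP vy.
by have := vP y => /= <-; rewrite vy; apply/ex; exists (b y).
Qed.

(** An extension to [P0] of a map from the syzygy to [K] exists in [Y]; composed
    with [f] it factors through [S], hence vanishes, so it lands in [K]. *)
Lemma perp_ker K Y Z (i : {linear K -> Y}) (f : {linear Y -> Z}) :
  injective i -> exact_at i f -> in_perp Y -> Hom_zero S Z -> in_perp K.
Proof.
move=> ii ex [hY eY] hZ; split; first exact: (Hom_zero_sub ii hY).
move=> g; have [h hP] := eY (i \o g).
have [t tP] : exists t : {linear S -> Z}, forall y, t (e y) = (f \o h) y.
  apply: (linear_factor se) => y /e0 [x <-]; rewrite /= hP.
  by apply/ex; exists (g x).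
have [k kP] : exists k : {linear P0 -> K}, forall y, i (k y) = h y.
  by apply: (linear_lift ii) => y; apply/ex; have := tP y; rewrite hZ.
by exists k => x; apply: ii; rewrite kP hP.
Qed.

Lemma perp_iso X Y (f : {linear X -> Y}) : injective f -> surj f -> in_perp X -> in_perp Y.
Proof.
move=> fi sf [hX eX]; split; last exact: (extends_quotient sf eX).
have [g [gK _]] := linear_inverse fi sf.
by move=> u s; rewrite -(gK (u s)); have := hX (g \o u) s => /= ->; rewrite linear0.
Qed.

Lemma perp_zero Z : is_zero Z -> in_perp Z.
Proof.
by move=> Z0; split=> [f s|g]; [exact: Z0 | exists \0 => x; rewrite (Z0 (g x))].
Qed.

Lemma perp_dsum X Y : in_perp X -> in_perp Y -> in_perp (X [+] Y).
Proof.
move=> [hX eX] [hY eY]; split=> [f s|g].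
  rewrite [f s]surjective_pairing; have /= -> := hX (dfst X Y \o f) s.
  by have /= -> := hY (dsnd X Y \o f) s.
have [h hP] := eX (dfst X Y \o g); have [k kP] := eY (dsnd X Y \o g).
by exists (pairing h k) => x; rewrite /= hP kP /= -surjective_pairing.
Qed.

End Presentation.

Section Filtration.
Variable S : fgModType A.
Hypothesis simS : simple S.

(** Modules with a filtration with all factors isomorphic to submodules of the
    simple module [S]; allowing zero factors makes the class visibly closed
    under submodules. *)
Inductive filt : fgModType A -> Prop :=
| filt_zero M : is_zero M -> filt M
| filt_step M' M (i : {linear M' -> M}) (p : {linear M -> S}) :
    filt M' -> injective i -> exact_at i p -> filt M.

Lemma filt_sub M N (j : {linear N -> M}) : injective j -> filt M -> filt N.
Proof.
move=> ji fM; elim: fM N j ji => [{}M M0 N j ji|M' {}M i p fM' IH ii ex N j ji].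
  by apply: filt_zero => x; apply: (linear_inj0 ji); exact: M0.
have [K [k [ki kP]]] := sub_fg flA (submod_ker (p \o j)).
have [l lP] : exists l : {linear K -> M'}, forall x, i (l x) = (j \o k) x.
  by apply: (linear_lift ii) => x; apply/ex; apply/kP; exists x.
apply: (filt_step (i := k) (p := p \o j)) => //.
apply: (IH K l); apply: linear_inj => x lx.
by apply: (linear_inj0 (inj_comp ji ki)); rewrite -[LHS](lP x) lx linear0.
Qed.

Lemma filt_class (Pr : fgModType A -> Prop) :
  (forall M, is_zero M -> Pr M) ->
  (forall M N (f : {linear M -> N}), injective f -> surj f -> Pr M -> Pr N) ->
  (forall K M (i : {linear K -> M}) (p : {linear M -> S}), ses i p -> Pr K -> Pr M) ->
  forall M, filt M -> Pr M.
Proof.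
move=> Pr0 Priso Prext M; elim=> {M} [//|M' M i p _ PM' ii ex].
have [[x px]|p0] := pselect (exists x, p x <> 0).
  by apply: (Prext _ _ i p) PM'; split=> //; exact: (simple_surj simS (ex_intro _ x px)).
apply: Priso ii _ PM' => x; apply/ex.
by apply: contrapT => px; apply: p0; exists x.
Qed.

Lemma filt_Hom0 M Z : filt M -> Hom_zero S Z -> forall (f : {linear M -> Z}) x, f x = 0.
Proof.
move=> fM hZ; move: M fM; apply: filt_class => [M M0 f x|M N g gi sg IH f x|K M i p s IH f x].
- by rewrite (M0 x) linear0.
- by have [y <-] := sg x; exact: (IH (f \o g)).
have [_ sp ex] := s; have [g gP] : exists g : {linear S -> Z}, forall y, g (p y) = f y.
  by apply: (linear_factor sp) => y /ex [z <-]; exact: (IH (f \o i)).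
by rewrite -gP hZ.
Qed.

Lemma filt_Hom_zero M : filt M -> Hom_zero S M -> is_zero M.
Proof. by move=> fM hM x; exact: (filt_Hom0 fM hM idfun). Qed.

(** Take [K] maximal among the filtered submodules: the preimage of the image of
    a nonzero map [S -> X / K] would be a larger one. *)
Lemma torsion X : exists K Q (i : {linear K -> X}) (p : {linear X -> Q}),
  [/\ ses i p, filt K & Hom_zero S Q].
Proof.
have [n bn] := flA X.
pose P (N : X -> Prop) := is_submodule N /\ exists K (i : {linear K -> X}),
  [/\ injective i, forall x, N x <-> exists k, i k = x & filt K].
have [||N [hN [K [i [ii iP fK]]]] Nmax] := @bound_max _ X n P (fun x => x = 0) bn.
- by move=> N [].
- split; first exact: submod_zero.
  have [K [i [ii iP]]] := sub_fg flA (@submod_zero _ X).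
  exists K, i; split=> //; apply: filt_zero => k; apply: (linear_inj0 ii).
  by apply/iP; exists k.
have [Q [p [sp kp]]] := quot_fg hN.
exists K, Q, i, p; split=> //.
  by split=> // x; rewrite kp.
move=> f s; apply: contrapT => fs.
have fi : injective f by apply: simple_inj => //; exists s.
have hW := submod_preim p (submod_range f).
have [W [w [wi wP]]] := sub_fg flA hW.
have [x px] := sp (f s).
apply: fs; rewrite -px; apply/kp; apply: (Nmax (fun x => exists s, f s = p x)).
- split=> //; exists W, w; split=> //.
  have [q qP] : exists q : {linear W -> S}, forall z, f (q z) = (p \o w) z.
    by apply: (linear_lift fi) => z; apply/wP; exists z.
  have [k kP] : exists k : {linear K -> W}, forall z, w (k z) = i z.
    apply: (linear_lift wi) => z; apply/wP; exists 0.
    by rewrite linear0; apply/esym/kp/iP; exists z.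
  apply: (filt_step (i := k) (p := q)) => //.
    by apply: linear_inj => z kz; apply: (linear_inj0 ii); rewrite -kP kz linear0.
  move=> z; split=> [qz|[y <-]].
    have /kp /iP [y iy] : p (w z) = 0 by rewrite -[LHS](qP z) qz linear0.
    by exists y; apply: wi; rewrite kP.
  by apply: (linear_inj0 fi); rewrite qP /= kP; apply/kp/iP; exists y.
- by move=> y /kp ->; exists 0; rewrite linear0.
- by exists s.
Qed.

End Filtration.
End Perpendicular.

(** * Exactness of the localization functor *)

Section Localization.
Variable A : pzRingType.
Implicit Types C K M P Q T W X Y Z : fgModType A.
Hypothesis flA : finite_length_ring A.
Hypothesis injA : forall M : fgModType A,
  exists (I : fgModType A) (u : {linear M -> I}), injective_module I /\ injective u.
Variables (S P0 P1 : fgModType A) (d : {linear P1 -> P0}) (e : {linear P0 -> S}).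
Hypotheses (simS : simple S) (pP0 : projective P0) (pP1 : projective P1) (sS : ses d e).
Variable F : left_adjoint S.

Local Notation perp Z := (in_perp S d Z).
Local Notation L X := (perp_obj (ilam F X)).
Local Notation "'Lmap' f" := (ilam_map F f) (at level 10).
Local Notation eta X := (Defs.eta F X).
Local Notation filt := (filt S).

Definition mk_perp (Z : fgModType A) (h : perp Z) : perpType S :=
  Perp ((in_perpP pP0 sS Z).1 h).

Lemma perp_of (X : perpType S) : perp X.
Proof. exact/(in_perpP pP0 sS)/perpP. Qed.

Lemma perpL X : perp (L X). Proof. exact: perp_of. Qed.

Lemma perp_Hom0 (X : perpType S) : Hom_zero S X.
Proof. by case: (perp_of X). Qed.

Lemma eta_cancel X (Z : fgModType A) (f : {linear L X -> Z}) : perp Z ->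
  (forall x, f (eta X x) = 0) -> forall y, f y = 0.
Proof.
move=> pZ f0 y; apply: (@eta_ext A S F X (mk_perp pZ) f \0 _ y) => x.
by rewrite f0.
Qed.

(** Let [K] be the largest filtered submodule of [X], and [T] that of an
    injective module [I] containing [X / K]. Then [X / K] meets [T] trivially, so it
    embeds into [I / T]. This quotient lies in [S^perp], so the unit is injective
    on [X / K]. *)
Lemma eta_ker X : exists (K : fgModType A) (i : {linear K -> X}),
  [/\ filt K, injective i & exact_at i (eta X)].
Proof.
have [K [Q [i [p [s fK hQ]]]]] := torsion flA simS X.
have [ii sp ex] := s.
exists K, i; split=> // x; split=> [ex0|[k <-]]; last first.
  exact: (filt_Hom0 simS fK (@perp_Hom0 (ilam F X)) (eta X \o i)).
apply/ex.
have [I [u [iI ui]]] := injA Q.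
have [T [Z [j [q [sq fT hZ]]]]] := torsion flA simS I; have [ji sq' exq] := sq.
have pZ : perp Z.
  by split=> //; exact: (extends_quotient pP1 sq' (injective_extends sS iI)).
have qu : injective (q \o u).
  (* The kernel is filtered, being contained in T, but admits no map from S. *)
  have [N [n [ni nP]]] := sub_fg flA (submod_ker (q \o u)).
  have [t tP] : exists t : {linear N -> T}, forall y, j (t y) = (u \o n) y.
    by apply: (linear_lift ji) => y; apply/exq; apply/nP; exists y.
  have fN : filt N.
    apply: (filt_sub flA (j := t)) fT; apply: linear_inj => y ty.
    by apply: (linear_inj0 (inj_comp ui ni)); rewrite -[LHS](tP y) ty linear0.
  have N0 := filt_Hom_zero simS fN (Hom_zero_sub ni hQ).
  by apply: linear_inj => y /nP [z <-]; rewrite (N0 z) linear0.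
have [g gP _] := eta_universal F (Y := mk_perp pZ) (q \o u \o p).
by apply: (linear_inj0 qu); have := gP x; rewrite ex0 linear0 => /esym.
Qed.

(** The cokernel of the unit is filtered: the preimage of its largest filtered
    submodule is an object of S^perp through which the unit factors, hence all
    of [L X] by universality. *)
Lemma eta_coker X : exists (C : fgModType A) (c : {linear L X -> C}),
  [/\ filt C, surj c & exact_at (eta X) c].
Proof.
have [C [c [sc kc]]] := quot_fg (submod_range (eta X)).
exists C, c; split=> //.
have [T [Q [j [q [[ji sq exq] fT hQ]]]]] := torsion flA simS C.
have scq : surj (q \o c).
  by move=> z; have [y <-] := sq z; have [x <-] := sc y; exists x.
have [Y [y [yi _ yex]]] := ker_ses flA scq.
have pY : perp Y := perp_ker sS yi yex (perpL X) hQ.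
have [h hP] : exists h : {linear X -> Y}, forall x, y (h x) = eta X x.
  apply: (linear_lift yi) => x; apply/yex => /=.
  by have -> : c (eta X x) = 0; [apply/kc; exists x | rewrite linear0].
have [g gP _] := eta_universal F (Y := mk_perp pY) h.
have yg z : y (g z) = z.
  apply: (@eta_ext A S F X (ilam F X) (y \o g) idfun _ z) => x.
  by rewrite /= gP hP.
have q0 z : q z = 0.
  by have [x <-] := sc z; rewrite -(yg x); apply/yex; exists (g x).
have [i [_ iK]] := bij_retract ji (fun z => (exq z).1 (q0 z)).
exact: filt_sub (can_inj iK) fT.
Qed.

(** The kernel of [L f] lies in [S^perp] and meets the image of the unit
    trivially. So it embeds into the cokernel of the unit, hence is filtered; a
    filtered module in [S^perp] is zero. *)
Lemma L_inj X Y (f : {linear X -> Y}) : injective f -> injective (Lmap f).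
Proof.
move=> fi.
have [N [n [ni nP]]] := sub_fg flA (submod_ker (Lmap f)).
have pN : perp N.
  by apply: (perp_ker sS ni (f := Lmap f)) => [y||]; [exact: nP | exact: perpL | exact: perp_Hom0].
have [C [c [fC sc exc]]] := eta_coker X.
have [K [i [fK ii exi]]] := eta_ker Y.
(* The elements of X killed in L Y form a filtered module. *)
have [W [w [wi wP]]] := sub_fg flA (submod_ker (eta Y \o f)).
have [k kP] : exists k : {linear W -> K}, forall z, i (k z) = (f \o w) z.
  by apply: (linear_lift ii) => z; apply/exi; apply/wP; exists z.
have fW : filt W.
  apply: (filt_sub flA (j := k)) fK; apply: linear_inj => z kz.
  by apply: (linear_inj0 (inj_comp fi wi)); rewrite -[LHS](kP z) kz linear0.
have cn : injective (c \o n).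
  apply: linear_inj => x /= /exc [z ez]; apply: (linear_inj0 ni); rewrite -ez.
  have /wP [v <-] : (eta Y \o f) z = 0.
    by rewrite /= -eta_natural ez; apply/nP; exists x.
  exact: (filt_Hom0 simS fW (@perp_Hom0 (ilam F X)) (eta X \o w)).
have N0 : is_zero N by apply: (filt_Hom_zero simS (filt_sub flA cn fC)); case: pN.
by apply: linear_inj => y /nP [x <-]; rewrite (N0 x) linear0.
Qed.

(** Right exactness is that of a left adjoint, because cokernels of maps in
    [S^perp] lie in [S^perp]. *)
Lemma L_ses X Y Z (f : {linear X -> Y}) (g : {linear Y -> Z}) :
  ses f g -> ses (Lmap f) (Lmap g).
Proof.
move=> [fi sg ex]; split; first exact: L_inj.
  move=> z; have [Q [q [sq kq]]] := quot_fg (submod_range (Lmap g)).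
  have pQ : perp Q.
    by apply: (perp_coker flA pP0 pP1 sS sq (f := Lmap g)) => //; exact: perpL.
  apply/kq; apply: (eta_cancel pQ) => x; have [y <-] := sg x.
  by apply/kq; exists (eta Y y); rewrite eta_natural.
move=> y; split=> [gy|[x <-]]; last first.
  have z x' : (Lmap g \o Lmap f) x' = 0.
    apply: (eta_cancel (f := Lmap g \o Lmap f)) => [|{}x']; first exact: perpL.
    have /= gf : g (f x') = 0 by apply/ex; exists x'.
    by rewrite /= !eta_natural gf linear0.
  exact: z.
have [Q [q [sq kq]]] := quot_fg (submod_range (Lmap f)).
have pQ : perp Q.
  by apply: (perp_coker flA pP0 pP1 sS sq (f := Lmap f)) => //; exact: perpL.
have [h hP] : exists h : {linear Z -> Q}, forall y, h (g y) = (q \o eta Y) y.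
  apply: (linear_factor sg) => z /ex [x <-].
  by apply/kq; exists (eta X x); rewrite eta_natural.
have [k kP _] := eta_universal F (Y := mk_perp pQ) h.
apply/kq.
have -> : q y = k (Lmap g y); last by rewrite gy linear0.
apply: (@eta_ext A S F Y (mk_perp pQ) q (k \o Lmap g)) => x.
by rewrite /= eta_natural kP hP.
Qed.

(** * Modules over the localization *)

Local Notation B := (retraction F).
Implicit Types J N U V : fgModType (retraction F).

Fact perp_map_linear (X Y : perpType S) (f : {linear X -> Y}) :
  linear (f : perp_mod F X -> perp_mod F Y).
Proof.
move=> l x y.
have E : f (perp_act (F := F) l x) = perp_act (F := F) l (f x).
  apply: (perp_act_unique (F := F) (x := f x) (g := fun l => f (perp_act (F := F) l x))).
    by move=> a p q; rewrite perp_act_linear linearP.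
  by move=> a; rewrite perp_act_eta linearZ.
by rewrite -[RHS]/(perp_act (F := F) l (f x) + f y) -E -linearD.
Qed.
Definition perp_map (X Y : perpType S) (f : {linear X -> Y}) :
  {linear perp_mod F X -> perp_mod F Y} :=
  @mklin B (perp_mod F X) (perp_mod F Y) f (perp_map_linear f).

Fact retraction_fg : finitely_generated (restr (retraction_map F) B^o).
Proof.
have [n [g gP]] := fgmodP (ilam F (regular_mod A)).
exists n, g => x; have [c ->] := gP x; exists c; apply: eq_bigr => i _.
rewrite -[RHS]/(star (retraction_map F (c i)) (g i)) starE.
exact/esym/(@perp_act_eta A S F (ilam F (regular_mod A))).
Qed.

Definition res (N : fgModType B) : fgModType A := FgMod (restr_fg N retraction_fg).
Definition res_map (M N : fgModType B) (u : {linear M -> N}) : {linear res M -> res N} :=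
  restr_map (retraction_map F) u.

Hypothesis flB : finite_length_ring B.

Lemma res_regular : exists f : {linear L (regular_mod A) -> res (regular_mod B)}, f =1 id.
Proof.
have lf : linear (id : L (regular_mod A) -> res (regular_mod B)).
  move=> a x y; congr (_ + _).
  rewrite -[RHS]/(star (retraction_map F a) x) starE.
  exact/esym/(@perp_act_eta A S F (ilam F (regular_mod A))).
by exists (mklin lf).
Qed.

(** A module over the localization is a cokernel of a map between free ones, and
    these lie in [S^perp]. *)
Lemma res_perp N : perp (res N).
Proof.
have pfree n : perp (res (free_mod B n)).
  elim: n => [|n IH]; first by apply: perp_zero => x; exact: (zero_modP x).
  have lid : linear (id : res (free_mod B n) [+] res (regular_mod B) ->
                          res (free_mod B n.+1)) by [].
  apply: (perp_iso pP1 (f := mklin lid)) => //; first by move=> x; exists x.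
  apply: perp_dsum => //; have [f fE] := res_regular.
  apply: (perp_iso pP1 (f := f)); last exact: perpL.
    by move=> x y; rewrite !fE.
  by move=> x; exists x; rewrite fE.
have [n [p sp]] := free_cover N; have [K [i [ii _ ex]]] := ker_ses flB sp.
have [m [q sq]] := free_cover K.
apply: (perp_coker flA pP0 pP1 sS (f := res_map (i \o q)) (q := res_map p) sp) => //.
move=> x; rewrite -[res_map p x]/(p x) ex; split=> [[y <-]|[y <-]].
  by have [z <-] := sq y; exists z.
by exists (q y).
Qed.

Definition perp_res N : perpType S := mk_perp (res_perp N).

(** The two actions of the localization agree on the image of [A], hence
    everywhere. *)
Lemma perp_act_res N (l : B) (x : N) : perp_act (F := F) (X := perp_res N) l x = l *: x.
Proof.
apply/esym; apply: (perp_act_unique (F := F) (X := perp_res N) (x := x)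
  (g := fun l : ilam F (regular_mod A) => (l : B) *: x : perp_res N)) => [a p q|a //].
rewrite scalerDl; congr (_ + _).
have -> : (a *: p : ilam F (regular_mod A)) = (retraction_map F a * (p : B)).
  rewrite -[RHS]/(star (retraction_map F a) p) starE.
  exact/esym/(@perp_act_eta A S F (ilam F (regular_mod A))).
by rewrite -scalerA.
Qed.

Lemma from_res N (X : perpType S) (f : {linear res N -> X}) :
  exists g : {linear N -> perp_mod F X}, forall x, g x = f x.
Proof.
have lg : linear (f : N -> perp_mod F X).
  move=> l x y; have := linearP (perp_map (X := perp_res N) f) l x y => /= <-.
  by congr (f (_ + y)); exact/esym/perp_act_res.
by exists (mklin lg).
Qed.

Lemma perp_to (X : perpType S) N (f : {linear X -> res N}) :
  exists g : {linear perp_mod F X -> N}, forall x, g x = f x.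
Proof.
have lg : linear (f : perp_mod F X -> N).
  move=> l x y; have := linearP (perp_map (Y := perp_res N) f) l x y => /= ->.
  by congr (_ + _); exact: perp_act_res.
by exists (mklin lg).
Qed.

Lemma to_perp N (X : perpType S) (f : {linear N -> perp_mod F X}) :
  exists g : {linear res N -> X}, forall x, g x = f x.
Proof.
have lg : linear (f : res N -> X).
  by move=> a x y; rewrite -(perp_scale_eta F); exact: linearP.
by exists (mklin lg).
Qed.

Lemma to_res (X : perpType S) N (f : {linear perp_mod F X -> N}) :
  exists g : {linear X -> res N}, forall x, g x = f x.
Proof.
have lg : linear (f : X -> res N).
  by move=> a x y; rewrite -(perp_scale_eta F) [LHS]linearP.
by exists (mklin lg).
Qed.

(** Restriction is right adjoint to the localization functor, which preserves
    monomorphisms. *)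
Lemma res_injective J : injective_module J -> injective_module (res J).
Proof.
move=> iJ X Y f g fi.
have [g1 g1P _] := eta_universal F (Y := perp_res J) g.
have [g2 g2P] := perp_to (N := J) g1.
have [h hP] := iJ _ _ (perp_map (Lmap f)) g2 (L_inj fi).
have [k kP] := to_res h.
exists (k \o eta Y) => x; rewrite /= kP -eta_natural.
by rewrite -g1P -g2P -hP.
Qed.

Lemma perp_injective (X : perpType S) : injective_module X -> injective_module (perp_mod F X).
Proof.
move=> iX U V f g fi.
have [g1 g1P] := to_perp g.
have [h hP] := iX _ _ (res_map f) g1 fi.
have [k kP] := from_res h.
by exists k => x; rewrite kP -g1P -hP.
Qed.

(** The localization functor is left adjoint to restriction, which is exact. *)
Lemma L_projective P : projective P -> projective (perp_mod F (ilam F P)).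
Proof.
move=> pP U V f g sf.
have [g1 g1P] := to_res g.
have [h hP] := pP _ _ (res_map f) (g1 \o eta P) sf.
have [h1 h1P _] := eta_universal F (Y := perp_res U) h.
have [k kP] := perp_to (N := U) h1.
exists k => x; rewrite -g1P kP.
apply: (@eta_ext A S F P (perp_res V) (res_map f \o h1) g1) => z.
by rewrite /= h1P; exact: hP.
Qed.

Lemma pd_le_L n X : pd_le n X -> pd_le n (perp_mod F (ilam F X)).
Proof.
elim: n X => [|n IH] X; first exact: L_projective.
move=> [P [K [i [p [pP s hK]]]]].
exists (perp_mod F (ilam F P)), (perp_mod F (ilam F K)), (perp_map (Lmap i)), (perp_map (Lmap p)).
by split; [exact: L_projective | exact: L_ses s | exact: IH].
Qed.

Lemma fpd_L X : fpd X -> fpd (perp_mod F (ilam F X)).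
Proof. by move=> [n h]; exists n; exact: pd_le_L. Qed.

Lemma res_ses (X Y Z : fgModType B) (f : {linear X -> Y}) (g : {linear Y -> Z}) :
  ses f g -> ses (res_map f) (res_map g).
Proof. by []. Qed.

Lemma fid_res N : fid N -> fid (res N).
Proof.
move=> [n h]; exists n; elim: n N h => [|n IH] N; first exact: res_injective.
move=> [I [C [i [p [iI s hC]]]]].
exists (res I), (res C), (res_map i), (res_map p).
by split; [exact: res_injective | exact: res_ses s | exact: IH].
Qed.

Lemma res_perp_mod J : exists2 g : {linear J -> perp_mod F (ilam F (res J))},
  injective g & surj g.
Proof.
have [g gP] := from_res (N := J) (X := ilam F (perp_res J)) (eta (perp_res J)).
have [k kK Kk] := eta_perp_bij F (perp_res J).
exists g; first by move=> x y; rewrite !gP => /(can_inj kK).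
by move=> y; exists (k y); rewrite gP; exact: Kk.
Qed.

Lemma perp_res_mod N : exists2 g : {linear N -> perp_mod F (perp_res N)}, injective g & surj g.
Proof.
have [g gP] := from_res (N := N) (X := perp_res N) idfun.
exists g; first by move=> x y; rewrite !gP.
by move=> y; exists y; rewrite gP.
Qed.

Lemma eta_factor X : exists (K Q C : fgModType A) (i : {linear K -> X}) (p : {linear X -> Q})
  (v : {linear Q -> L X}) (c : {linear L X -> C}), [/\ filt K, filt C, ses i p & ses v c].
Proof.
have [K [i [fK ii exi]]] := eta_ker X; have [C [c [fC sc exc]]] := eta_coker X.
have [Q [p s]] := coker_ses ii; have [_ sp ex] := s.
have [v vP] : exists v : {linear Q -> L X}, forall x, v (p x) = eta X x.
  by apply: (linear_factor sp) => x /ex /exi.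
exists K, Q, C, i, p, v, c; split=> //; split=> //.
  by apply: linear_inj => q; have [x <-] := sp q; rewrite vP => /exi /ex.
move=> y; rewrite exc; split=> [[x <-]|[q <-]]; first by exists (p x).
by have [x <-] := sp q; exists x.
Qed.

(** * Transfer of homological dimensions *)

Section ProjectiveDimension.
Hypothesis pdS : fpd S.

Lemma filt_fpd : forall K, filt K -> fpd K.
Proof.
apply: (filt_class simS) => [M M0|M N f fi sf hM|K M i p s hK].
- by exists 0%N; exact: zero_projective.
- exact: fpd_iso fi sf hM.
- exact: (fpd_ext flA s hK pdS).
Qed.

(** [X] and [L X] differ only by filtered modules. *)
Lemma fpd_L_iff X : fpd X <-> fpd (L X).
Proof.
have [K [Q [C [i [p [v [c [/filt_fpd hK /filt_fpd hC s s']]]]]]]] := eta_factor X.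
split=> h.
  by apply: (fpd_ext flA s') hC; exact: (fpd_coker flA s hK h).
by apply: (fpd_ext flA s hK); exact: (fpd_ker flA s' h hC).
Qed.

(** A projective module over the localization is a retract of the localization
    of a free one. *)
Lemma projective_res (P : fgModType B) : projective P -> fpd (res P).
Proof.
move=> pP; have [m [p sp]] := free_cover (res P).
have [g gP _] := eta_universal F (Y := perp_res P) p.
have [g' g'P] := perp_to (N := P) g.
have [|s sP] := pP _ _ g' idfun.
  by move=> y; have [x <-] := sp y; exists (eta (free_mod A m) x); rewrite g'P gP.
have [s' s'P] := to_perp s.
apply: (fpd_retract flA (s := s') (r := g)) => [x|]; first by rewrite s'P -g'P sP.
by apply: (fpd_L_iff (free_mod A m)).1; exists 0%N; exact: free_projective.
Qed.

Lemma fpd_res N : fpd N -> fpd (res N).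
Proof.
move=> [n]; elim: n N => [|n IH] N; first exact: projective_res.
move=> [P [K [i [p [pP s /IH hK]]]]].
exact: (fpd_coker flA (res_ses s) hK (projective_res pP)).
Qed.
End ProjectiveDimension.

Section InjectiveDimension.
Variables (A' : pzRingType) (D : duality A A').
Hypothesis flA' : finite_length_ring A'.
Hypothesis injB : forall M : fgModType B,
  exists (J : fgModType B) (u : {linear M -> J}), injective_module J /\ injective u.

(** An injective coresolution over the localization is also one over [A], where
    by Schanuel's lemma its cosyzygies become injective at the expected place. *)
Lemma res_fid N : fid (res N) -> fid N.
Proof.
move=> [n h]; exists n; elim: n N h => [|n IH] N h.
  have [g gi sg] := perp_res_mod N; have [k [gk _]] := bij_retract gi sg.
  exact: injective_retract gk (perp_injective (X := perp_res N) h).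
have [J [u [iJ ui]]] := injB N; have [C [c s]] := coker_ses ui.
exists J, C, u, c; split=> //; apply: IH.
exact: (id_le_cosyzygy D flA' (res_injective iJ) (res_ses s) h).
Qed.

Lemma filt_fid : fid S -> forall K, filt K -> fid K.
Proof.
move=> idS; apply: (filt_class simS) => [M M0|M N f fi sf hM|K M i p s hK].
- by exists 0%N; exact: zero_injective.
- exact: (fid_iso D flA' fi sf hM).
- exact: (fid_ext D flA' s hK idS).
Qed.

Lemma fid_L_iff X : fid S -> fid X <-> fid (L X).
Proof.
move=> idS; have [K [Q [C [i [p [v [c [fK fC s s']]]]]]]] := eta_factor X.
have hK := filt_fid idS fK; have hC := filt_fid idS fC.
split=> h.
  exact: (fid_ext D flA' s' (fid_coker D flA' s hK h) hC).
exact: (fid_ext D flA' s hK (fid_ker D flA' s' h hC)).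
Qed.
End InjectiveDimension.

(** * The injective envelope of the simple module *)

Section Envelope.
Variables (I : fgModType A) (j : {linear S -> I}).
Hypotheses (hI : injective_envelope j) (extS : Ext1_zero S S).

(** Since [Ext^1(S, S) = 0], a map from [S] to [I / S] lifts to [I]; by
    essentiality the lift lands in [S], so the map is zero. *)
Lemma envelope_quotient_perp Z (q : {linear I -> Z}) : ses j q -> perp Z.
Proof.
have [iI ji ess] := hI; move=> [_ sq ex].
split; last exact: (extends_quotient pP1 sq (injective_extends sS iI)).
move=> f s; have [_ se exe] := sS.
have [t tP] := pP0 (f \o e) sq.
have [a aP] : exists a : {linear P1 -> S}, forall x, j (a x) = (t \o d) x.
  apply: (linear_lift ji) => x; apply/ex; rewrite /= tP /=.
  by have -> : e (d x) = 0; [apply/exe; exists x | rewrite linear0].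
have [b bP] := Ext1_extends sS extS a.
have [k kP] : exists k : {linear S -> I}, forall y, k (e y) = (t \- (j \o b)) y.
  apply: (linear_factor se) => y /exe [x <-].
  by rewrite /= bP aP subrr.
have qk y : q (k y) = f y.
  have [x <-] := se y; rewrite kP /= linearB tP /=.
  by have -> : q (j (b x)) = 0; [apply/ex; exists (b x) | rewrite subr0].
rewrite -qk; apply/ex.
(* By essentiality the simple image of k meets that of j, hence lies in it. *)
have [C [r [sr kr]]] := quot_fg (submod_range k).
have [rji|nrj] := pselect (injective (r \o j)).
  exists 0; rewrite linear0; apply/esym; apply: (linear_inj0 (ess C r rji)).
  by apply/kr; exists s.
have [x0 [x00 rx0]] : exists x, x <> 0 /\ r (j x) = 0.
  apply: contrapT => nn; apply: nrj; apply: linear_inj => x rx.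
  by apply: contrapT => x0; apply: nn; exists x.
have /kr [y ky] := rx0.
have y0 : y <> 0.
  by move=> y0; apply: x00; apply: (linear_inj0 ji); rewrite -ky y0 linear0.
have [c ->] := simple_generated simS y0 s.
by exists (c *: x0); rewrite !linearZ ky.
Qed.

(** The unit at [I] has kernel [S] and is surjective: [I / S] is the localization
    of [I]. *)
Lemma envelope_ses : ses j (eta I).
Proof.
have [iI ji ess] := hI.
have [Z [q s]] := coker_ses ji; have pZ := envelope_quotient_perp s; have [_ sq ex] := s.
have [g gP _] := eta_universal F (Y := mk_perp pZ) q.
have [h hP] : exists h : {linear Z -> L I}, forall x, h (q x) = eta I x.
  apply: (linear_factor sq) => x /ex [y <-].
  exact: (@perp_Hom0 (ilam F I) (eta I \o j)).
have hg y : h (g y) = y.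
  apply: (@eta_ext A S F I (ilam F I) (h \o g) idfun) => x.
  by rewrite /= gP hP.
split=> // [y|x].
  by have [x ex'] := sq (g y); exists x; rewrite -hP ex' hg.
rewrite -(ex x); split=> h0; last by rewrite -hP h0 linear0.
by rewrite -gP h0 linear0.
Qed.

Lemma filt_copies M : filt M -> exists m (u : {linear M -> copies I m}), injective u.
Proof.
have [iI ji _] := hI.
move: M; apply: (filt_class simS) => [M M0|M N f fi sf [m [u ui]]|K M i p s [m [u ui]]].
- by exists 0%N, \0 => x y _; rewrite (M0 x) (M0 y).
- have [g [_ gf]] := bij_retract fi sf.
  by exists m, (u \o g); apply: inj_comp => //; exact: can_inj gf.
have [ii _ ex] := s.
have [h hP] := copies_injective iI u ii.
exists m.+1, (pairing h (j \o p)); apply: linear_inj => x [hx /(linear_inj0 ji) /ex [z ez]].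
by move: hx; rewrite -ez hP => /(linear_inj0 ui) ->; rewrite linear0.
Qed.

(** An injective module is a retract of the sum of some copies of [I] and an
    injective module over the localization: the former receive its largest
    filtered submodule, the latter the quotient by it, which lies in [S^perp]. *)
Lemma injective_fpd : fpd S -> fpd I ->
  (forall M : fgModType B, exists (J : fgModType B) (u : {linear M -> J}),
     injective_module J /\ injective u) ->
  (forall J : fgModType B, injective_module J -> fpd J) ->
  forall I' : fgModType A, injective_module I' -> fpd I'.
Proof.
move=> pdS pdI injB fpdB I' iI'; have [iI _ _] := hI.
have [K [Q [i [p [s fK hQ]]]]] := torsion flA simS I'; have [ii sp ex] := s.
have pQ : perp Q.
  by split=> //; exact: (extends_quotient pP1 sp (injective_extends sS iI')).
have [J [w [iJ wi]]] := injB (perp_mod F (mk_perp pQ)).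
have [w' w'P] := to_res w.
have [m [u ui]] := filt_copies fK.
have [b bP] := copies_injective iI u ii.
have pi : injective (pairing b (w' \o p)).
  apply: linear_inj => x [bx]; rewrite /= w'P => /(linear_inj0 wi) /ex [z ez].
  by move: bx; rewrite -ez bP => /(linear_inj0 ui) ->; rewrite linear0.
have [r rP] := iI' _ _ _ idfun pi.
apply: (fpd_retract flA (s := pairing b (w' \o p)) (r := r)) => //.
apply: (fpd_ext flA (ses_dinl _ _) (fpd_copies flA m pdI)).
exact/(fpd_res pdS)/fpdB.
Qed.
End Envelope.

End Localization.

(** * Gorenstein algebras *)

Section ConverseRing.
Variables (R : comPzRingType) (A : pzRingType) (sc : {rmorphism R -> A}).
Hypotheses (hsc : central sc) (fgA : finitely_generated (restr sc A^o)).

Definition conv_sc (r : R) : A^c := sc r.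
Fact conv_sc_zmod : zmod_morphism conv_sc.
Proof. by move=> r s; exact: (rmorphB sc). Qed.
Fact conv_sc_monoid : monoid_morphism conv_sc.
Proof.
split=> [|r s]; first exact: (rmorph1 sc).
by rewrite /conv_sc mulrC; exact: (rmorphM sc).
Qed.
HB.instance Definition _ := GRing.isZmodMorphism.Build R A^c conv_sc conv_sc_zmod.
HB.instance Definition _ := GRing.isMonoidMorphism.Build R A^c conv_sc conv_sc_monoid.

Fact conv_central : central conv_sc.
Proof. by move=> r a; exact/esym/hsc. Qed.
Fact conv_anti : antimorphism (id : A^c -> A). Proof. by []. Qed.
Fact conv_anti' : antimorphism (id : A -> A^c). Proof. by []. Qed.
Fact conv_fg : finitely_generated (restr conv_sc A^c^o).
Proof.
have [n [e eP]] := fgA; exists n, e => x; have [c ->] := eP x; exists c.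
by apply: eq_bigr => i _; exact: hsc.
Qed.

Definition converse_algebras : opposite_algebras R A A^c :=
  @OppositeAlgebras R A A^c sc conv_sc id id hsc conv_central conv_anti conv_anti'
    (fun=> erefl) (fun=> erefl) (fun=> erefl) (fun=> erefl) fgA conv_fg.

Hypothesis hR : artinian R.

Lemma converse_finite_length : finite_length_ring A /\ finite_length_ring A^c.
Proof. by split; [exact: (finite_length_algebra hR fgA) | exact: (finite_length_algebra hR conv_fg)]. Qed.

Lemma converse_duality : inhabited (duality A A^c).
Proof.
have [E [mE iE sE]] := dualizing_exists hR.
exact: inhabits (algebra_duality hR mE iE sE converse_algebras).
Qed.

End ConverseRing.

(** The condition on the right regular module is traded for one on left modules,
    to which the localization functor applies. *)
Lemma gorensteinP (A : pzRingType) : duality A A^c -> finite_length_ring A ->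
  gorenstein A <-> fid (regular_mod A) /\ forall I : fgModType A, injective_module I -> fpd I.
Proof.
move=> D flA; have [h1 h2] := fid_opposite D flA.
split=> -[/inj_dim_finiteP h].
  by move=> /inj_dim_finiteP /h1.
by move=> /h2 /inj_dim_finiteP h'; split=> //; exact/inj_dim_finiteP.
Qed.

Lemma restr_trans_fg (R A B : pzRingType) (f : {rmorphism R -> A}) (g : {rmorphism A -> B}) :
  finitely_generated (restr f A^o) -> finitely_generated (restr g B^o) ->
  finitely_generated (restr (g \o f : {rmorphism R -> B}) B^o).
Proof.
move=> fgA fgB; have fgR := restr_fg (FgMod fgB) fgA.
have lid : linear (id : restr f (restr g B^o) -> restr (g \o f : {rmorphism R -> B}) B^o) by [].
by apply: (fg_surj (f := mklin lid)) fgR => x; exists x.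
Qed.

Section RetractionAlgebra.
Variables (R : comPzRingType) (A : pzRingType) (sc : {rmorphism R -> A}).
Hypothesis hsc : central sc.
Variables (S : fgModType A) (F : left_adjoint S).

(** Left and right multiplication by an element of [R] are [A]-linear and agree
    on the image of [A]. *)
Lemma retraction_central : central (retraction_map F \o sc).
Proof.
move=> r b.
rewrite -[LHS]/(star (retraction_map F (sc r)) b) -[RHS]/(star b (retraction_map F (sc r))).
rewrite !starE perp_act_eta.
apply: (perp_act_unique (F := F) (X := ilam F (regular_mod A)) (x := retraction_map F (sc r))
  (g := fun b : ilam F (regular_mod A) => sc r *: b)) => [a p q|a].
  by rewrite scalerDr !scalerA hsc.
rewrite /retraction_map -!linearZ; congr (Defs.eta F _ _).
exact: hsc.
Qed.
End RetractionAlgebra.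

Theorem theorem2p8 (R : comNzRingType) (A : algType R)
    (hA : artin_algebra A)
    (S : fgModType A) (hS : localizable S)
    (F : left_adjoint S)
    (I : fgModType A) (j : {linear S -> I}) (hI : injective_envelope j) :
  gorenstein A <->
    gorenstein (retraction F) /\ proj_dim_finite (perp_mod F (ilam F I)).
Proof.
have [hR fgA] := hA; have [simS pdS extS] := hS.
pose sc : {rmorphism R -> A} := in_alg A.
have hsc : central sc by move=> r a; rewrite /= mulr_algl mulr_algr.
have fgsc : finitely_generated (restr sc A^o).
  have [n [e eP]] := fgA; exists n, e => x; have [c ->] := eP x; exists c.
  by apply: eq_bigr => i _; rewrite -mulr_algl.
pose scB : {rmorphism R -> retraction F} := retraction_map F \o sc.
have hscB : central scB := retraction_central hsc (F := F).
have fgB : finitely_generated (restr scB (retraction F)^o).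
  exact: restr_trans_fg fgsc (retraction_fg F).
have [flA flA'] := converse_finite_length hsc fgsc hR.
have [flB flB'] := converse_finite_length hscB fgB hR.
have [D] := converse_duality hsc fgsc hR.
have [DB] := converse_duality hscB fgB hR.
have [P0 [P1 [d [e [pP0 sS pP1]]]]] := resolution_pd_le flA pdS.
have injA := enough_injectives D; have injB := enough_injectives DB.
have fpdS : fpd S by exists 1%N; exists P0, P1, d, e.
have [iI ji _] := hI.
have gorA := gorensteinP D flA; have gorB := gorensteinP DB flB.
have resB_inj := res_injective flA injA simS pP0 pP1 sS flB.
rewrite proj_dim_finiteP //; split.
  move=> /gorA [fidA fpdA].
  have fidS : fid S := fpd_fid D flA' fidA fpdS.
  split; last first.
    exact: (fpd_L flA injA simS pP0 pP1 sS flB (fpdA _ iI)).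
  apply/gorB; split.
    (* The regular module of L(A), restricted to A, differs from A by filtered
       modules. *)
    apply: (res_fid flA injA simS pP0 pP1 sS flB D flA' injB).
    have [f fE] := res_regular F.
    apply: (fid_iso D flA' (f := f)); [by move=> x y; rewrite !fE | by move=> x; exists x; rewrite fE|].
    exact: (fid_L_iff flA injA simS pP0 pP1 sS F D flA' _ fidS).1.
  (* J is the localization of its restriction, which is injective over A. *)
  move=> J iJ; have [g gi sg] := res_perp_mod flA pP0 pP1 sS flB J.
  have [k [gk kg]] := bij_retract gi sg.
  apply: (fpd_retract flB gk).
  exact: (fpd_L flA injA simS pP0 pP1 sS flB (fpdA _ (resB_inj _ iJ))).
move=> [/gorB [fidB fpdB] fpdLI].
have resLI := to_perp (F := F) (X := ilam F I) idfun.
have [g gE] := resLI.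
have gi : injective g by move=> x y; rewrite !gE.
have sg : surj g by move=> x; exists x; rewrite gE.
have sE := envelope_ses simS pP0 pP1 sS F hI extS.
(* Both dimensions of I(S) / S = L(I(S)) are finite over L(A), hence over A. *)
have fidS : fid S.
  apply: (fid_ker D flA' sE); first by exists 0%N.
  apply: (fid_iso D flA' gi sg).
  exact: (fid_res flA injA simS pP0 pP1 sS flB (fpd_fid DB flB' fidB fpdLI)).
have fpdI : fpd I.
  apply: (fpd_ext flA sE fpdS); apply: (fpd_iso gi sg).
  exact: (fpd_res flA injA simS pP0 pP1 sS flB fpdS fpdLI).
apply/gorA; split.
  apply: (fid_L_iff flA injA simS pP0 pP1 sS F D flA' _ fidS).2.
  have [f fE] := res_regular F.
  have fi : injective f by move=> x y; rewrite !fE.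
  have fs : surj f by move=> x; exists x; rewrite fE.
  have [f' [ff' f'f]] := bij_retract fi fs.
  have f's : surj f' by move=> x; exists (f x); exact: ff'.
  have f'i : injective f' by exact: can_inj f'f.
  apply: (fid_iso D flA' f'i f's).
  exact: (fid_res flA injA simS pP0 pP1 sS flB fidB).
exact: (injective_fpd flA injA simS pP0 pP1 sS flB hI fpdS fpdI injB fpdB).
Qed.
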